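(* There is an assignment, to each lax monoidal category $(A,\otimes^n,\iota,\gamma)$, of a simplicial map $\alpha:\mathbb{C}\to N_\Delta(N_2\mathsf{Cat})$ such that $(A,\otimes^n,\iota,\gamma)$ can be recovered completely from $\alpha$; that is, the assignment $(A,\otimes^n,\iota,\gamma)\mapsto\alpha$ is injective.
   Context: Conventions. All categories are small, $I$ is the terminal category. The product of categories (and functors) is treated as strictly associative and unital: $(A\times B)\times C=A\times(B\times C)$, $A\times I=A=I\times A$ (one replaces the monoidal 2-category $\mathsf{Cat}$ by an equivalent strict one). $\circ$ denotes composition of functors and horizontal composition of natural transformations, $\bullet$ vertical composition. Lax monoidal category $(A,\otimes^n,\gamma,\iota)$: a category $A$; functors $\otimes^n:A^n\to A$ for $n\ge 0$ ($A^0=I$); natural transformations $\gamma_{n,k_1,\dots,k_n}:\otimes^n\circ(\otimes^{k_1}\times\dots\times\otimes^{k_n})\Rightarrow\otimes^{k_1+\dots+k_n}$ for all $n,k_1,\dots,k_n\ge 0$; and a natural transformation $\iota:1_A\Rightarrow\otimes^1$. Axioms. Associativity: for all $n,k_i,m_{ij}$ ($1\le i\le n$, $1\le j\le k_i$), with $M_i=m_{i1}+\dots+m_{ik_i}$, $$\gamma_{n,M_1,\dots,M_n}\bullet\bigl(1\circ(\gamma_{k_1,m_{11},\dots,m_{1k_1}}\times\dots\times\gamma_{k_n,m_{n1},\dots,m_{nk_n}})\bigr)=\gamma_{k_1+\dots+k_n,m_{11},\dots,m_{nk_n}}\bullet(\gamma_{n,k_1,\dots,k_n}\circ 1).$$ Unitality: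 $\gamma_{1,n}\bullet(\iota\circ 1_{\otimes^n})=1_{\otimes^n}$ and $\gamma_{n,1,\dots,1}\bullet(1_{\otimes^n}\circ(\iota\times\dots\times\iota))=1_{\otimes^n}$ for all $n$. Catalan simplicial set $\mathbb{C}$: one $0$-simplex $*$; two $1$-simplices $0=s_0( * )$ and $1$; five $2$-simplices, determined by their edges $(x_{0,1},x_{1,2},x_{0,2})$: $s_0(0)=(0,0,0)$, $s_0(1)=(0,1,1)$, $s_1(1)=(1,0,1)$, $u=(0,0,1)$, $m=(1,1,1)$; higher simplices are determined by $2$-coskeletality (every $n$-boundary, $n>2$, has a unique filler). Homotopy coherent nerve. $S[n]$ is the simplicially enriched category with objects $0,\dots,n$; for $p\le q$, $S[n](p,q)$ is the nerve of the poset of subsets of $\{p,\dots,q\}$ containing $p$ and $q$ (and $S[n](p,q)=\emptyset$ for $q<p$). A $k$-simplex is written as a chain $C_0\subseteq\dots\subseteq C_k$; orientation: an inclusion $C_0\subseteq C_1$ is an arrow from $C_1$ to $C_0$, so $d_i$ deletes $C_{k-i}$. Composition is union, identities are $\{p\}$. For a simplicially enriched category $U$, $N_\Delta(U)_n$ is the set of simplicially enriched functors $S[n]\to U$; an order-preserving map $[m]\to[n]$ induces $S[m]\to S[n]$ by direct image of subsets, and acts on $N_\Delta(U)$ by precomposition. $N_2(\mathsf{Cat})$ is the simplicially enriched category with one object $*$ whose mapping simplicial set has: $0$-simplices categories; $1$-simplices functors $T$ ($d_1T$ the domain, $d_0T$ the codomain); $2$-simplices natural transformations $\eta:T_{12}\circ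 T_{01}\Rightarrow T_{02}$ ($d_0\eta=T_{12}$, $d_1\eta=T_{02}$, $d_2\eta=T_{01}$); $3$-simplices families $\eta_{ijk}:T_{jk}\circ T_{ij}\Rightarrow T_{ik}$ ($0\le i<j<k\le3$) with $\eta_{013}\bullet(\eta_{123}\circ1)=\eta_{023}\bullet(1\circ\eta_{012})$; higher simplices by $3$-coskeletality; degeneracies insert identities. Composition is given by $\times$, with identity $I$. $N_\Delta(N_2\mathsf{Cat})$ is its homotopy coherent nerve. *)

(* Defs.v *)
From mathcomp Require Import all_boot.
From Stdlib Require Import FunctionalExtensionality ProofIrrelevance.

Set Implicit Arguments.
Unset Strict Implicit.
Unset Printing Implicit Defensive.

(** * Categories, functors, natural transformations *)

(* Small categories in the "objects and arrows" style, with [dom] and [cod] as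
   functions rather than a dependent family of hom-sets.  This keeps equations
   between arrows whose end points agree only propositionally (for example by
   associativity of concatenation) free of transports.  Here and below, axioms
   quantify over all proofs of composability; such proofs always follow from
   the [dom]/[cod] axioms, so no equation is vacuous. *)
Record category := Category {
  Ob : Type;
  Mor : Type;
  dom : Mor -> Ob;
  cod : Mor -> Ob;
  idm : Ob -> Mor;
  compm : forall g f : Mor, cod f = dom g -> Mor;
  dom_idm : forall x, dom (idm x) = x;
  cod_idm : forall x, cod (idm x) = x;
  dom_compm : forall g f e, dom (@compm g f e) = dom f;
  cod_compm : forall g f e, cod (@compm g f e) = cod g;
  compm_idl : forall f e, @compm (idm (cod f)) f e = f;
  compm_idr : forall f e, @compm f (idm (dom f)) e = f;
  compm_assoc : forall h g f e1 e2 e3 e4,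
    @compm h (@compm g f e1) e2 = @compm (@compm h g e3) f e4
}.
Arguments Category {Ob Mor dom cod idm compm} _ _ _ _ _ _ _.
Arguments dom {c} _.
Arguments cod {c} _.
Arguments idm {c} _.
Arguments compm {c} _ _ _.

Record functor (A B : category) := Functor {
  Fo : Ob A -> Ob B;
  Fm : Mor A -> Mor B;
  dom_Fm : forall f, dom (Fm f) = Fo (dom f);
  cod_Fm : forall f, cod (Fm f) = Fo (cod f);
  Fm_idm : forall x, Fm (idm x) = idm (Fo x);
  Fm_compm : forall g f e e', Fm (compm g f e) = compm (Fm g) (Fm f) e'
}.
Arguments Functor {A B Fo Fm} _ _ _ _.
Arguments Fo {A B} _ _.
Arguments Fm {A B} _ _.
Arguments dom_Fm {A B} _ _.
Arguments cod_Fm {A B} _ _.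
Arguments Fm_idm {A B} _ _.
Arguments Fm_compm {A B} _ _ _ _ _.

Record nattrans (A B : category) (F G : functor A B) := NatTrans {
  nt :> Ob A -> Mor B;
  dom_nt : forall x, dom (nt x) = Fo F x;
  cod_nt : forall x, cod (nt x) = Fo G x;
  nt_natural : forall f e e',
    compm (nt (cod f)) (Fm F f) e = compm (Fm G f) (nt (dom f)) e'
}.
Arguments NatTrans {A B F G nt} _ _ _.
Arguments dom_nt {A B F G} _ _.
Arguments cod_nt {A B F G} _ _.
Arguments nt_natural {A B F G} _ _ _ _.

Lemma compm_eq (A : category) (g g' f f' : Mor A) e e' :
  g = g' -> f = f' -> compm g f e = compm g' f' e'.
Proof. by move=> eg ef; subst; congr compm; exact: proof_irrelevance. Qed.

Definition idF (A : category) : functor A A.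
Proof.
by apply: (@Functor _ _ id id) => // g f e e'; exact: compm_eq.
Defined.

Definition compF (A B C : category) (G : functor B C) (F : functor A B) :
  functor A C.
Proof.
apply: (@Functor _ _ (fun x => Fo G (Fo F x)) (fun f => Fm G (Fm F f))).
- by move=> f; rewrite !dom_Fm.
- by move=> f; rewrite !cod_Fm.
- by move=> x; rewrite !Fm_idm.
- move=> g f e e'.
  have e1 : cod (Fm F f) = dom (Fm F g) by rewrite cod_Fm dom_Fm e.
  by rewrite (Fm_compm F g f e e1) (Fm_compm G _ _ e1 e').
Defined.

(** * Finite products of categories *)


(* Tuples of objects ([P := Ob]) or of arrows ([P := Mor]) over a list of
   categories. *)
Fixpoint hprod (P : category -> Type) (w : seq category) : Type :=
  match w with
  | [::] => unit
  | A :: w' => (P A * hprod P w')%type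
  end.

Fixpoint hmap (P Q : category -> Type) (f : forall A, P A -> Q A)
    (w : seq category) : hprod P w -> hprod Q w :=
  match w return hprod P w -> hprod Q w with
  | [::] => fun _ => tt
  | A :: w' => fun x => (f A x.1, hmap f x.2)
  end.

Section HProd.
Variable P : category -> Type.

Fixpoint happ (w v : seq category) : hprod P w -> hprod P v -> hprod P (w ++ v) :=
  match w return hprod P w -> hprod P v -> hprod P (w ++ v) with
  | [::] => fun _ y => y
  | A :: w' => fun x y => (x.1, happ x.2 y)
  end.

Fixpoint htake (w v : seq category) : hprod P (w ++ v) -> hprod P w :=
  match w return hprod P (w ++ v) -> hprod P w with
  | [::] => fun _ => tt
  | A :: w' => fun x => (x.1, htake x.2)
  end.

Fixpoint hdrop (w v : seq category) : hprod P (w ++ v) -> hprod P v :=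
  match w return hprod P (w ++ v) -> hprod P v with
  | [::] => fun x => x
  | A :: w' => fun x => hdrop x.2
  end.

Lemma htake_app w v (x : hprod P w) (y : hprod P v) : htake (happ x y) = x.
Proof. by elim: w x => [|A w IH] /= [] // a x; rewrite IH. Qed.

Lemma hdrop_app w v (x : hprod P w) (y : hprod P v) : hdrop (happ x y) = y.
Proof. by elim: w x => [|A w IH] /= [] // a x; rewrite IH. Qed.

Lemma happ_take_drop w v (x : hprod P (w ++ v)) : happ (htake x) (hdrop x) = x.
Proof. by elim: w x => [|A w IH] //= [a x]; rewrite IH. Qed.

(* Forgets the typing of a tuple; used to compare tuples over lists of
   categories that are only propositionally equal. *)
Fixpoint hlist (w : seq category) : hprod P w -> seq {A : category & P A} :=
  match w return hprod P w -> seq {A : category & P A} with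
  | [::] => fun _ => [::]
  | A :: w' => fun x => existT P A x.1 :: hlist x.2
  end.

Lemma hlist_inj w : injective (@hlist w).
Proof.
elim: w => [|A w IH] /=; first by case; case.
by move=> [a x] [b y] /= [/(@inj_pairT2 _ _ _ _ _) -> /IH ->].
Qed.

Lemma size_hlist w (x : hprod P w) : size (hlist x) = size w.
Proof. by elim: w x => [|A w IH] //= x; rewrite IH. Qed.

Lemma hlist_app w v (x : hprod P w) (y : hprod P v) :
  hlist (happ x y) = hlist x ++ hlist y.
Proof. by elim: w x => [|A w IH] //= x; rewrite IH. Qed.

Lemma hlist_take_drop w v (x : hprod P (w ++ v)) :
  hlist x = hlist (htake x) ++ hlist (hdrop x).
Proof. by rewrite -hlist_app happ_take_drop. Qed.

Lemma hlist_cat_inj (w : seq category) (x x' : hprod P w)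
    s s' :
  hlist x ++ s = hlist x' ++ s' -> x = x' /\ s = s'.
Proof.
move=> h; have hs : size (hlist x) = size (hlist x') by rewrite !size_hlist.
split.
  by apply: hlist_inj; move/(congr1 (take (size (hlist x)))): h;
    rewrite take_size_cat // hs take_size_cat.
by move/(congr1 (drop (size (hlist x)))): h;
  rewrite drop_size_cat // hs drop_size_cat.
Qed.

Lemma hlist_assoc (w v u : seq category) (x : hprod P (w ++ (v ++ u)))
    (y : hprod P ((w ++ v) ++ u)) :
  hlist x = hlist y ->
  [/\ htake x = htake (htake y), htake (hdrop x) = hdrop (htake y) &
      hdrop (hdrop x) = hdrop y].
Proof.
rewrite [hlist x]hlist_take_drop [hlist (hdrop x)]hlist_take_drop.
rewrite [hlist y]hlist_take_drop [hlist (htake y)]hlist_take_drop -catA.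
by case/hlist_cat_inj=> -> /hlist_cat_inj[-> /hlist_inj->].
Qed.

Lemma hlist_unitr (w : seq category) (x : hprod P w) (y : hprod P (w ++ [::])) :
  hlist y = hlist x -> htake y = x.
Proof.
by rewrite [hlist y]hlist_take_drop; case: (hdrop y); rewrite cats0 => /hlist_inj.
Qed.
End HProd.

Lemma hmap_app P Q (f : forall A, P A -> Q A) w v
    (x : hprod P w) (y : hprod P v) :
  hmap f (happ x y) = happ (hmap f x) (hmap f y).
Proof. by elim: w x => [|A w IH] //= x; rewrite IH. Qed.

Lemma hmap_take P Q (f : forall A, P A -> Q A) w v (x : hprod P (w ++ v)) :
  hmap f (htake x) = htake (hmap f x).
Proof. by elim: w x => [|A w IH] //= x; rewrite IH. Qed.

Lemma hmap_drop P Q (f : forall A, P A -> Q A) w v (x : hprod P (w ++ v)) :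
  hmap f (hdrop x) = hdrop (hmap f x).
Proof. by elim: w x => [|A w IH] //= x; rewrite IH. Qed.

Fixpoint hcomp (w : seq category) : forall g f : hprod Mor w,
    hmap (@cod) f = hmap (@dom) g -> hprod Mor w :=
  match w with
  | [::] => fun _ _ _ => tt
  | A :: w' => fun g f e =>
      (compm g.1 f.1 (congr1 fst e), hcomp (congr1 snd e))
  end.
Arguments hcomp {w} g f e.

Lemma hcomp_eq w (g g' f f' : hprod Mor w) e e' :
  g = g' -> f = f' -> hcomp g f e = hcomp g' f' e'.
Proof. by move=> eg ef; subst; congr hcomp; exact: proof_irrelevance. Qed.

Lemma hcomp_app w v (g f : hprod Mor w) (g' f' : hprod Mor v) e e1 e2 :
  hcomp (happ g g') (happ f f') e = happ (hcomp g f e1) (hcomp g' f' e2).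
Proof.
elim: w g f e e1 => [|A w IH] /= g f e e1; first exact: hcomp_eq.
by congr pair; [exact: compm_eq | exact: IH].
Qed.

(* The product category [A_1 * ... * A_n] of a list of categories. *)
Definition cprod (w : seq category) : category.
Proof.
apply: (@Category (hprod Ob w) (hprod Mor w) (hmap (@dom) (w := w))
  (hmap (@cod) (w := w)) (hmap (@idm) (w := w)) (@hcomp w)).
- by elim: w => [|A w IH] /= [] // a x; rewrite dom_idm IH.
- by elim: w => [|A w IH] /= [] // a x; rewrite cod_idm IH.
- by elim: w => [|A w IH] //= g f e; rewrite dom_compm IH.
- by elim: w => [|A w IH] //= g f e; rewrite cod_compm IH.
- by elim: w => [|A w IH] /= [] // f1 f2 e; rewrite compm_idl IH.
- by elim: w => [|A w IH] /= [] // f1 f2 e; rewrite compm_idr IH.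
- elim: w => [|A w IH] //= h g f e1 e2 e3 e4.
  by congr pair; [exact: compm_assoc | exact: IH].
Defined.

(** * A strict monoidal model of the 2-category of categories *)

(* The monoidal 2-category of categories is strictified in the usual way: a
   0-cell is a word (list) of categories, standing for the product of its
   letters; 1-cells and 2-cells are functors and natural transformations
   between these products.  The tensor product of 0-cells is concatenation and
   the unit is the empty word, so that it is strictly associative and unital.
   A category [A] is regarded as the one-letter word [[:: A]]. *)
Definition word := seq category.

Definition word_functor (w v : word) := functor (cprod w) (cprod v).

Definition tensF (w w' v v' : word) (F : word_functor w w')
  (G : word_functor v v') : word_functor (w ++ v) (w' ++ v').
Proof.
apply: (@Functor (cprod (w ++ v)) (cprod (w' ++ v'))
  (fun x => happ (Fo F (htake x)) (Fo G (hdrop x)))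
  (fun f => happ (Fm F (htake f)) (Fm G (hdrop f)))).
- move=> f /=; rewrite hmap_app -hmap_take -hmap_drop.
  by congr happ; [exact (dom_Fm F _) | exact (dom_Fm G _)].
- move=> f /=; rewrite hmap_app -hmap_take -hmap_drop.
  by congr happ; [exact (cod_Fm F _) | exact (cod_Fm G _)].
- move=> x /=; rewrite hmap_app -hmap_take -hmap_drop.
  by congr happ; [exact (Fm_idm F _) | exact (Fm_idm G _)].
- move=> g f e e' /=.
  have ht : hmap (@cod) (htake f) = hmap (@dom) (htake g).
    by rewrite !hmap_take; congr htake; exact: e.
  have hd : hmap (@cod) (hdrop f) = hmap (@dom) (hdrop g).
    by rewrite !hmap_drop; congr hdrop; exact: e.
  have ec : hcomp g f e = happ (hcomp (htake g) (htake f) ht)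
                               (hcomp (hdrop g) (hdrop f) hd).
    have e0 : hmap (@cod) (happ (htake f) (hdrop f)) =
              hmap (@dom) (happ (htake g) (hdrop g)).
      by rewrite !happ_take_drop; exact: e.
    by rewrite -(hcomp_app e0); apply: hcomp_eq; rewrite happ_take_drop.
  have e1 : hmap (@cod) (Fm F (htake f)) = hmap (@dom) (Fm F (htake g)).
    exact: etrans (cod_Fm F _) (etrans (congr1 (Fo F) ht) (esym (dom_Fm F _))).
  have e2 : hmap (@cod) (Fm G (hdrop f)) = hmap (@dom) (Fm G (hdrop g)).
    exact: etrans (cod_Fm G _) (etrans (congr1 (Fo G) hd) (esym (dom_Fm G _))).
  rewrite ec htake_app hdrop_app (hcomp_app _ e1 e2).
  by congr happ; [exact (Fm_compm F _ _ ht e1) | exact (Fm_compm G _ _ hd e2)].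
Defined.

Definition tensN (w0 w1 w2 v0 v1 v2 : word)
  (F01 : word_functor w0 w1) (F12 : word_functor w1 w2)
  (F02 : word_functor w0 w2) (G01 : word_functor v0 v1)
  (G12 : word_functor v1 v2) (G02 : word_functor v0 v2)
  (s : nattrans (compF F12 F01) F02) (t : nattrans (compF G12 G01) G02) :
  nattrans (compF (tensF F12 G12) (tensF F01 G01)) (tensF F02 G02).
Proof.
apply: (@NatTrans _ _ (compF (tensF F12 G12) (tensF F01 G01)) (tensF F02 G02)
  (fun x : hprod Ob (w0 ++ v0) => happ (s (htake x)) (t (hdrop x))
     : hprod Mor (w2 ++ v2))).
- move=> x /=; rewrite hmap_app htake_app hdrop_app.
  by congr happ; [exact (dom_nt s _) | exact (dom_nt t _)].
- move=> x /=; rewrite hmap_app.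
  by congr happ; [exact (cod_nt s _) | exact (cod_nt t _)].
- move=> f /=; rewrite -!hmap_take -!hmap_drop !htake_app !hdrop_app => e e'.
  have e1 : cod (Fm (compF F12 F01) (htake f)) =
            dom (s (cod (htake f : Mor (cprod w0)))).
    exact: etrans (cod_Fm (compF F12 F01) _) (esym (dom_nt s _)).
  have e2 : cod (Fm (compF G12 G01) (hdrop f)) =
            dom (t (cod (hdrop f : Mor (cprod v0)))).
    exact: etrans (cod_Fm (compF G12 G01) _) (esym (dom_nt t _)).
  have e3 : cod (s (dom (htake f : Mor (cprod w0)))) = dom (Fm F02 (htake f)).
    exact: etrans (cod_nt s _) (esym (dom_Fm F02 _)).
  have e4 : cod (t (dom (hdrop f : Mor (cprod v0)))) = dom (Fm G02 (hdrop f)).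
    exact: etrans (cod_nt t _) (esym (dom_Fm G02 _)).
  rewrite (hcomp_app _ e1 e2) (hcomp_app _ e3 e4).
  by congr happ; [exact (nt_natural s _ e1 e3) | exact (nt_natural t _ e2 e4)].
Defined.

(** * Simplicial sets and simplicially enriched categories *)

(* Monotone maps [m] -> [n], where [n] = {0, ..., n} = 'I_n.+1. *)
Record mono (m n : nat) := Mono {
  mf :> 'I_m.+1 -> 'I_n.+1;
  mfP : forall i j : 'I_m.+1, i <= j -> mf i <= mf j
}.

Definition mono_id n : mono n n := @Mono n n id (fun _ _ h => h).

Definition mono_comp m n p (g : mono n p) (f : mono m n) : mono m p :=
  @Mono m p (fun i => g (f i)) (fun _ _ h => mfP g (mfP f h)).

Record sset := SSet {
  simp :> nat -> Type;
  act : forall m n, mono m n -> simp n -> simp m;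
  act_id : forall n (x : simp n), act (mono_id n) x = x;
  act_comp : forall m n p (g : mono n p) (f : mono m n) (x : simp p),
    act (mono_comp g f) x = act f (act g x)
}.
Arguments SSet {simp act} _ _.
Arguments act {s m n} f x.

Record smap (X Y : sset) := SMap {
  sm :> forall n, X n -> Y n;
  sm_act : forall m n (f : mono m n) (x : X n),
    sm (act f x) = act f (sm x)
}.
Arguments SMap {X Y sm} _.

Lemma smap_eq (X Y : sset) (F G : smap X Y) :
  (forall n (x : X n), F n x = G n x) -> F = G.
Proof.
case: F => F hF; case: G => G hG /= FG.
have {}FG : F = G by do 2 apply: functional_extensionality_dep => ?.
by subst G; congr SMap; exact: proof_irrelevance.
Qed.

(* Composition is written in diagrammatic order; [sid x k] is the identity
   vertex of [hom x x], degenerated to dimension [k]. *)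
Record scat := SCat {
  sob : Type;
  hom : sob -> sob -> sset;
  scomp : forall x y z k, hom x y k -> hom y z k -> hom x z k;
  sid : forall x k, hom x x k;
  scomp_act : forall x y z m n (f : mono m n) (a : hom x y n) (b : hom y z n),
    act f (scomp a b) = scomp (act f a) (act f b);
  sid_act : forall x m n (f : mono m n), act f (sid x n) = sid x m;
  scomp_assoc : forall x y z t k (a : hom x y k) (b : hom y z k) (c : hom z t k),
    scomp a (scomp b c) = scomp (scomp a b) c;
  scomp_idl : forall x y k (a : hom x y k), scomp (sid x k) a = a;
  scomp_idr : forall x y k (a : hom x y k), scomp a (sid y k) = a
}.
Arguments SCat {sob hom scomp sid} _ _ _ _ _.
Arguments hom {s} _ _.
Arguments scomp {s x y z k} a b.
Arguments sid {s} x k.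

Record sfunctor (U V : scat) := SFunctor {
  fob : sob U -> sob V;
  fhom : forall x y, smap (hom x y) (hom (fob x) (fob y));
  fhom_comp : forall x y z k (a : hom x y k) (b : hom y z k),
    fhom x z k (scomp a b) = scomp (fhom x y k a) (fhom y z k b);
  fhom_id : forall x k, fhom x x k (sid x k) = sid (fob x) k
}.
Arguments SFunctor {U V fob fhom} _ _.
Arguments fob {U V} _ _.
Arguments fhom {U V} _ _ _.

Lemma sfunctor_eq (U V : scat) (o : sob U -> sob V)
    (h h' : forall x y, smap (hom x y) (hom (o x) (o y))) c i c' i' :
  (forall x y k (a : hom x y k), h x y k a = h' x y k a) ->
  @SFunctor U V o h c i = @SFunctor U V o h' c' i'.
Proof.
move=> hh; have {}hh : h = h'.
  by do 2 apply: functional_extensionality_dep => ?; exact: smap_eq.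
by subst h'; congr SFunctor; exact: proof_irrelevance.
Qed.

Definition sfunctor_comp (U V W : scat) (G : sfunctor V W) (F : sfunctor U V) :
  sfunctor U W.
Proof.
unshelve eapply (@SFunctor U W (fun x => fob G (fob F x))).
- move=> x y.
  apply: (@SMap _ _ (fun k a => fhom G (fob F x) (fob F y) k (fhom F x y k a))).
  by move=> m n f a; rewrite !sm_act.
- by move=> x y z k a b /=; rewrite !fhom_comp.
- by move=> x k /=; rewrite !fhom_id.
Defined.

(** * The simplicially enriched categories [S[n]] *)

Definition between n (p q : 'I_n.+1) (C : {set 'I_n.+1}) : bool :=
  [&& p \in C, q \in C & [forall i in C, p <= i <= q]].

Lemma betweenP n (p q : 'I_n.+1) (C : {set 'I_n.+1}) :
  reflect [/\ p \in C, q \in C & forall i, i \in C -> p <= i <= q]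
          (between p q C).
Proof.
apply: (iffP and3P) => -[hp hq h]; split=> //; first exact/forall_inP.
exact/forall_inP.
Qed.

(* A [k]-simplex of [S[n](p, q)]: a chain [C_0 <= ... <= C_k] of subsets of
   [{p, ..., q}] containing [p] and [q], of which [vert i] is [C_{k-i}], so
   that the face [d_i] deletes [C_{k-i}].  There is none when [q < p]. *)
Record chain n (p q : 'I_n.+1) (k : nat) := Chain {
  vert : 'I_k.+1 -> {set 'I_n.+1};
  vert_between : forall i, between p q (vert i);
  vert_sub : forall i j : 'I_k.+1, i <= j -> vert j \subset vert i
}.
Arguments Chain {n p q k vert} _ _.

Lemma chain_eq n (p q : 'I_n.+1) k (c d : chain p q k) :
  (forall i, vert c i = vert d i) -> c = d.
Proof.
case: c => c h1 h2; case: d => d h3 h4 /= cd.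
have {}cd : c = d by apply: functional_extensionality_dep.
by subst d; congr Chain; exact: proof_irrelevance.
Qed.

Definition chain_act n (p q : 'I_n.+1) k l (f : mono k l) (c : chain p q l) :
  chain p q k :=
  @Chain n p q k (fun i => vert c (f i)) (fun i => vert_between c (f i))
    (fun _ _ h => vert_sub c (mfP f h)).

Definition chains n (p q : 'I_n.+1) : sset.
Proof.
apply: (@SSet (chain p q) (fun k l => @chain_act n p q k l)).
- by move=> k x; exact: chain_eq.
- by move=> k l m g f x; exact: chain_eq.
Defined.

Lemma between_union n (p q r : 'I_n.+1) C D :
  between p q C -> between q r D -> between p r (C :|: D).
Proof.
move=> /betweenP[pC qC hC] /betweenP[qD rD hD]; apply/betweenP; split.
- by rewrite inE pC.
- by rewrite inE rD orbT.
have /andP[pq _] := hC _ qC; have /andP[_ qr] := hD _ qD.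
move=> i; rewrite inE => /orP[/hC|/hD] /andP[h1 h2]; apply/andP; split=> //.
  exact: leq_trans h2 _.
exact: leq_trans pq _.
Qed.

Definition chain_union n (p q r : 'I_n.+1) k (c : chain p q k)
  (d : chain q r k) : chain p r k :=
  @Chain n p r k (fun i => vert c i :|: vert d i)
    (fun i => between_union (vert_between c i) (vert_between d i))
    (fun _ _ h => setUSS (vert_sub c h) (vert_sub d h)).

Lemma between_point n (p : 'I_n.+1) : between p p [set p].
Proof. by apply/betweenP; split=> [||i]; rewrite inE // => /eqP->; rewrite leqnn. Qed.

Definition chain_point n (p : 'I_n.+1) k : chain p p k :=
  @Chain n p p k (fun _ => [set p]) (fun _ => between_point p)
    (fun _ _ _ => subxx _).

Definition cohS (n : nat) : scat.
Proof.
apply: (@SCat 'I_n.+1 (@chains n) (fun p q r k => @chain_union n p q r k)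
  (@chain_point n)).
- by move=> p q r k l f c d; exact: chain_eq.
- by move=> p k l f; exact: chain_eq.
- by move=> p q r s k c d e; apply: chain_eq => i /=; rewrite setUA.
- move=> p q k c; apply: chain_eq => i /=; apply/setUidPr; rewrite sub1set.
  by case/betweenP: (vert_between c i).
- move=> p q k c; apply: chain_eq => i /=; apply/setUidPl; rewrite sub1set.
  by case/betweenP: (vert_between c i).
Defined.

Lemma between_imset m n (f : mono m n) (p q : 'I_m.+1) C :
  between p q C -> between (f p) (f q) (f @: C).
Proof.
move=> /betweenP[pC qC hC]; apply/betweenP; split; try exact: imset_f.
by move=> _ /imsetP[i /hC /andP[h1 h2] ->]; rewrite !mfP.
Qed.

Definition chain_image m n (f : mono m n) (p q : 'I_m.+1) k (c : chain p q k) :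
  chain (f p) (f q) k :=
  @Chain n (f p) (f q) k (fun i => f @: vert c i)
    (fun i => between_imset f (vert_between c i))
    (fun _ _ h => imsetS f (vert_sub c h)).

Definition cohS_map m n (f : mono m n) : sfunctor (cohS m) (cohS n).
Proof.
unshelve eapply (@SFunctor (cohS m) (cohS n) f).
- move=> p q; apply: (@SMap (chains p q) (chains (f p) (f q))
    (fun k => @chain_image m n f p q k)).
  by move=> k l g c; exact: chain_eq.
- by move=> p q r k c d; apply: chain_eq => i /=; rewrite imsetU.
- by move=> p k; apply: chain_eq => i /=; rewrite imset_set1.
Defined.

(** * The homotopy coherent nerve *)

Definition hc_nerve (U : scat) : sset.
Proof.
apply: (@SSet (fun n => sfunctor (cohS n) U)
  (fun m n f F => sfunctor_comp F (cohS_map f))).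
- move=> n [o h c i]; apply: sfunctor_eq => p q k a /=.
  by congr (h p q k _); apply: chain_eq => j /=; rewrite imset_id.
- move=> m n r g f F; apply: sfunctor_eq => p q k a /=.
  by congr (fhom F _ _ k _); apply: chain_eq => j /=; rewrite imset_comp.
Defined.

(** * The simplicially enriched category [N_2(Cat)] *)

(* By 3-coskeletality an [n]-simplex is a family of 3-simplices indexed by the
   simplices of dimension at most 3 of the standard [n]-simplex, compatible
   with faces and degeneracies; since 3-simplices are families of 2-simplices,
   it amounts to the data below.  The indices are only weakly increasing, and
   the degenerate members of the family are required to be identities. *)
Record nsimp (n : nat) := NSimp {
  nob : 'I_n.+1 -> word;
  nfun : forall i j : 'I_n.+1, i <= j -> word_functor (nob i) (nob j);
  nnat : forall (i j k : 'I_n.+1) (ij : i <= j) (jk : j <= k) (ik : i <= k),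
    nattrans (compF (nfun jk) (nfun ij)) (nfun ik);
  nfun_id : forall (i : 'I_n.+1) (ii : i <= i), nfun ii = idF (cprod (nob i));
  nnat_idl : forall (i j : 'I_n.+1) (ii : i <= i) (ij ij' : i <= j) x,
    nnat ii ij ij' x = idm (Fo (nfun ij) x);
  nnat_idr : forall (i j : 'I_n.+1) (jj : j <= j) (ij ij' : i <= j) x,
    nnat ij jj ij' x = idm (Fo (nfun ij) x);
  nnat_coh : forall (i j k l : 'I_n.+1) (ij : i <= j) (jk : j <= k)
      (kl : k <= l) (ik : i <= k) (jl : j <= l) (il : i <= l) x e e',
    compm (nnat ij jl il x) (nnat jk kl jl (Fo (nfun ij) x)) e =
    compm (nnat ik kl il x) (Fm (nfun kl) (nnat ij jk ik x)) e'
}.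
Arguments NSimp {n nob nfun nnat} _ _ _ _.
Arguments nob {n} _ _.
Arguments nfun {n} _ {i j} _.
Arguments nnat {n} _ {i j k} _ _ _.
Arguments nnat_idl {n} _ {i j} _ _ _ _.
Arguments nnat_idr {n} _ {i j} _ _ _ _.
Arguments nnat_coh {n} _ {i j k l} _ _ _ _ _ _ _ _ _.

Lemma functor_eq (A B : category) (F G : functor A B) :
  (forall x, Fo F x = Fo G x) -> (forall f, Fm F f = Fm G f) -> F = G.
Proof.
case: F => Fo Fm a b c d; case: G => Go Gm a' b' c' d' /= ho hm.
have {}ho : Fo = Go by apply: functional_extensionality_dep.
have {}hm : Fm = Gm by apply: functional_extensionality_dep.
by subst Go Gm; congr Functor; exact: proof_irrelevance.
Qed.

Lemma nattrans_eq (A B : category) (F G : functor A B) (s t : nattrans F G) :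
  (forall x, s x = t x) -> s = t.
Proof.
case: s => s a b c; case: t => t a' b' c' /= st.
have {}st : s = t by apply: functional_extensionality_dep.
by subst t; congr NatTrans; exact: proof_irrelevance.
Qed.

Lemma nsimp_eq n (X Y : nsimp n) :
  (forall i, nob X i = nob Y i) ->
  (forall (i j : 'I_n.+1) (ij : i <= j) x y, hlist x = hlist y ->
     hlist (Fo (nfun X ij) x : hprod Ob _) =
     hlist (Fo (nfun Y ij) y : hprod Ob _)) ->
  (forall (i j : 'I_n.+1) (ij : i <= j) f g, hlist f = hlist g ->
     hlist (Fm (nfun X ij) f : hprod Mor _) =
     hlist (Fm (nfun Y ij) g : hprod Mor _)) ->
  (forall (i j k : 'I_n.+1) (ij : i <= j) (jk : j <= k) (ik : i <= k) x y,
     hlist x = hlist y ->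
     hlist (nnat X ij jk ik x : hprod Mor _) =
     hlist (nnat Y ij jk ik y : hprod Mor _)) ->
  X = Y.
Proof.
case: X => o f t a b c d; case: Y => o' f' t' a' b' c' d' /= ho.
have {}ho : o = o' by apply: functional_extensionality_dep.
subst o' => hfo hfm ht.
have hf : f = f'.
  do 3 apply: functional_extensionality_dep => ?.
  by apply: functor_eq => x; apply: hlist_inj; [exact: hfo | exact: hfm].
subst f'; have {}ht : t = t'.
  do 6 apply: functional_extensionality_dep => ?.
  by apply: nattrans_eq => x; apply: hlist_inj; exact: ht.
by subst t'; congr NSimp; exact: proof_irrelevance.
Qed.

Definition nsimp_act m n (f : mono m n) (X : nsimp n) : nsimp m.
Proof.
apply: (@NSimp m (fun i => nob X (f i)) (fun i j ij => nfun X (mfP f ij))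
  (fun i j k ij jk ik => nnat X (mfP f ij) (mfP f jk) (mfP f ik))).
- by move=> i ii; exact: nfun_id.
- by move=> i j ii ij ij' x; exact: nnat_idl.
- by move=> i j jj ij ij' x; exact: nnat_idr.
- by move=> i j k l ij jk kl ik jl il x e e'; exact: nnat_coh.
Defined.

Definition nsimps : sset.
Proof.
apply: (@SSet nsimp nsimp_act).
- move=> n X; apply: nsimp_eq => //=.
  + by move=> i j ij x y /hlist_inj ->.
  + by move=> i j ij f g /hlist_inj ->.
  + by move=> i j k ij jk ik x y /hlist_inj ->.
- move=> m n p g f X; apply: nsimp_eq => //=.
  + by move=> i j ij x y /hlist_inj ->.
  + by move=> i j ij h h' /hlist_inj ->.
  + by move=> i j k ij jk ik x y /hlist_inj ->.
Defined.

Definition nsimp_tens n (X Y : nsimp n) : nsimp n.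
Proof.
apply: (@NSimp n (fun i => nob X i ++ nob Y i)
  (fun i j ij => tensF (nfun X ij) (nfun Y ij))
  (fun i j k ij jk ik => tensN (nnat X ij jk ik) (nnat Y ij jk ik))).
- by move=> i ii; rewrite !nfun_id; apply: functor_eq => x /=;
    rewrite happ_take_drop.
- move=> i j ii ij ij' x /=; rewrite hmap_app.
  by congr happ; [exact (nnat_idl X ii ij ij' _) | exact (nnat_idl Y ii ij ij' _)].
- move=> i j jj ij ij' x /=; rewrite hmap_app.
  by congr happ; [exact (nnat_idr X jj ij ij' _) | exact (nnat_idr Y jj ij ij' _)].
- move=> i j k l ij jk kl ik jl il x; cbn.
  rewrite !htake_app !hdrop_app => e e'.
  have aux (Z : nsimp n) (z : Ob (cprod (nob Z i))) :
      cod (nnat Z jk kl jl (Fo (nfun Z ij) z)) = dom (nnat Z ij jl il z) /\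
      cod (Fm (nfun Z kl) (nnat Z ij jk ik z)) = dom (nnat Z ik kl il z).
    by rewrite cod_Fm !cod_nt !dom_nt.
  have [e1 e3] := aux X (htake x); have [e2 e4] := aux Y (hdrop x).
  rewrite (hcomp_app _ e1 e2) (hcomp_app _ e3 e4).
  by congr happ; [exact (nnat_coh X _ _ _ _ _ _ _ e1 e3) |
    exact (nnat_coh Y _ _ _ _ _ _ _ e2 e4)].
Defined.

Definition idN (A : category) : nattrans (compF (idF A) (idF A)) (idF A).
Proof.
apply: (@NatTrans _ _ (compF (idF A) (idF A)) (idF A) (@idm A)).
- exact: dom_idm.
- exact: cod_idm.
- by move=> f e e'; rewrite compm_idl compm_idr.
Defined.

Definition nsimp_unit n : nsimp n.
Proof.
apply: (@NSimp n (fun _ => [::]) (fun _ _ _ => idF (cprod [::]))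
  (fun _ _ _ _ _ _ => idN (cprod [::]))) => //.
Defined.

(* One object; the composite of [X : hom x y] and [Y : hom y z] is [X * Y]. *)
Definition N2Cat : scat.
Proof.
apply: (@SCat unit (fun _ _ => nsimps) (fun _ _ _ n X Y => nsimp_tens X Y)
  (fun _ n => nsimp_unit n)).
- move=> _ _ _ m n f X Y; apply: nsimp_eq => //=.
  + by move=> i j ij x y /hlist_inj ->.
  + by move=> i j ij x y /hlist_inj ->.
  + by move=> i j k ij jk ik x y /hlist_inj ->.
- move=> _ m n f; apply: nsimp_eq => //=.
- move=> _ _ _ _ n X Y Z.
  apply: nsimp_eq => [i|i j ij x y|i j ij x y|i j k ij jk ik x y] /=.
  + by rewrite catA.
  + by case/hlist_assoc=> -> -> ->; rewrite !hlist_app catA.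
  + by case/hlist_assoc=> -> -> ->; rewrite !hlist_app catA.
  + by case/hlist_assoc=> -> -> ->; rewrite !hlist_app catA.
- move=> _ _ n X.
  by apply: nsimp_eq => //= [i j ij x y|i j ij x y|i j k ij jk ik x y]
    /hlist_inj->.
- move=> _ _ n X.
  apply: nsimp_eq => /= [i|i j ij x y|i j ij x y|i j k ij jk ik x y].
  + by rewrite cats0.
  + by move/hlist_unitr=> ->; rewrite hlist_app cats0.
  + by move/hlist_unitr=> ->; rewrite hlist_app cats0.
  + by move/hlist_unitr=> ->; rewrite hlist_app cats0.
Defined.

(** * The Catalan simplicial set *)

(* The 2-simplices as triples (x_{01}, x_{12}, x_{02}) of edges, where [true]
   stands for the nondegenerate 1-simplex: s_0(0), s_0(1), s_1(1), u and m. *)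
Definition catalan_triangles : seq (bool * bool * bool) :=
  [:: (false, false, false); (false, true, true); (true, false, true);
      (false, false, true); (true, true, true)].

(* By 2-coskeletality an [n]-simplex is a compatible family of 2-simplices, and
   2-simplices are determined by their edges. *)
Record catalan_simp (n : nat) := CatalanSimp {
  edge : forall i j : 'I_n.+1, i <= j -> bool;
  edge_refl : forall (i : 'I_n.+1) (ii : i <= i), edge ii = false;
  edge_triangle : forall (i j k : 'I_n.+1) (ij : i <= j) (jk : j <= k)
    (ik : i <= k), (edge ij, edge jk, edge ik) \in catalan_triangles
}.
Arguments CatalanSimp {n edge} _ _.
Arguments edge {n} _ {i j} _.

Lemma catalan_simp_eq n (x y : catalan_simp n) :
  (forall (i j : 'I_n.+1) (ij : i <= j), edge x ij = edge y ij) -> x = y.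
Proof.
case: x => x a b; case: y => y c d /= xy.
have {}xy : x = y by do 3 apply: functional_extensionality_dep => ?.
by subst y; congr CatalanSimp; exact: proof_irrelevance.
Qed.

Definition catalan_act m n (f : mono m n) (x : catalan_simp n) :
  catalan_simp m :=
  @CatalanSimp m (fun i j ij => edge x (mfP f ij))
    (fun i ii => edge_refl x (mfP f ii))
    (fun i j k ij jk ik => edge_triangle x (mfP f ij) (mfP f jk) (mfP f ik)).

Definition Catalan : sset.
Proof.
apply: (@SSet catalan_simp catalan_act).
- by move=> n x; exact: catalan_simp_eq.
- by move=> m n p g f x; exact: catalan_simp_eq.
Defined.

(** * Lax monoidal categories *)

Definition pow (A : category) (n : nat) : category := cprod (nseq n A).

Fixpoint tuple_of (P : category -> Type) (A : category) (s : seq (P A)) :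
    hprod P (nseq (size s) A) :=
  match s return hprod P (nseq (size s) A) with
  | [::] => tt
  | x :: s' => (x, tuple_of s')
  end.

Section Tens.
Variables (A : category) (T : forall n, functor (pow A n) A).

(* Action of a family of functors [A^n -> A] on objects and arrows of [A^n],
   given as lists of length [n]. *)
Definition tens_ob (xs : seq (Ob A)) : Ob A := Fo (T (size xs)) (tuple_of xs).
Definition tens_mor (fs : seq (Mor A)) : Mor A := Fm (T (size fs)) (tuple_of fs).

Lemma hmap_tuple_of (U : forall n, hprod Ob (nseq n A) -> Ob A)
    (h : Mor A -> Ob A) (H : forall B : category, Mor B -> Ob B) fs :
  h = H A -> U _ (hmap H (tuple_of fs)) = U _ (tuple_of (map h fs)).
Proof.
move=> ->; elim: fs U => [|f fs IH] U //=.
exact: (IH (fun n t => U n.+1 (H A f, t))).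
Qed.

Lemma dom_tens_mor fs : dom (tens_mor fs) = tens_ob (map dom fs).
Proof. by rewrite [LHS]dom_Fm; exact: (hmap_tuple_of (fun n => Fo (T n))). Qed.

Lemma cod_tens_mor fs : cod (tens_mor fs) = tens_ob (map cod fs).
Proof. by rewrite [LHS]cod_Fm; exact: (hmap_tuple_of (fun n => Fo (T n))). Qed.
End Tens.

(* For objects x_{ij} (1 <= i <= n, 1 <= j <= k_i), arranged in a list of lists
   [xss], [lm_gamma xss] is the component of gamma_{n,k_1,...,k_n} at (x_{ij}),
   the indices n and k_i being the lengths of [xss] and of its members.
   Concatenation [flatten] is the identification of A^{k_1} * ... * A^{k_n}
   with A^{k_1+...+k_n}. *)
Record lax_monoidal_category := LaxMonoidal {
  lm_cat : category;
  tens : forall n, functor (pow lm_cat n) lm_cat;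
  lm_gamma : seq (seq (Ob lm_cat)) -> Mor lm_cat;
  lm_iota : Ob lm_cat -> Mor lm_cat;
  dom_gamma : forall xss,
    dom (lm_gamma xss) = tens_ob tens [seq tens_ob tens xs | xs <- xss];
  cod_gamma : forall xss, cod (lm_gamma xss) = tens_ob tens (flatten xss);
  gamma_natural : forall (fss : seq (seq (Mor lm_cat))) e e',
    compm (lm_gamma [seq map cod fs | fs <- fss])
          (tens_mor tens [seq tens_mor tens fs | fs <- fss]) e =
    compm (tens_mor tens (flatten fss)) (lm_gamma [seq map dom fs | fs <- fss]) e';
  dom_iota : forall x, dom (lm_iota x) = x;
  cod_iota : forall x, cod (lm_iota x) = tens_ob tens [:: x];
  iota_natural : forall f e e',
    compm (lm_iota (cod f)) f e = compm (tens_mor tens [:: f]) (lm_iota (dom f)) e';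
  gamma_assoc : forall (xsss : seq (seq (seq (Ob lm_cat)))) e e',
    compm (lm_gamma (map flatten xsss)) (tens_mor tens (map lm_gamma xsss)) e =
    compm (lm_gamma (flatten xsss))
          (lm_gamma [seq [seq tens_ob tens xs | xs <- xss] | xss <- xsss]) e';
  gamma_unitl : forall xs e,
    compm (lm_gamma [:: xs]) (lm_iota (tens_ob tens xs)) e = idm (tens_ob tens xs);
  gamma_unitr : forall xs e,
    compm (lm_gamma [seq [:: x] | x <- xs]) (tens_mor tens (map lm_iota xs)) e =
    idm (tens_ob tens xs)
}.
Arguments tens _ n : clear implicits.

(* The composites in the above axioms are all defined. *)
Section Composable.
Variable M : lax_monoidal_category.
Implicit Types (xs : seq (Ob (lm_cat M))) (fss : seq (seq (Mor (lm_cat M)))).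

Lemma gamma_natural_composable fss :
  cod (tens_mor (tens M) [seq tens_mor (tens M) fs | fs <- fss]) =
    dom (lm_gamma [seq map cod fs | fs <- fss]) /\
  cod (lm_gamma [seq map dom fs | fs <- fss]) =
    dom (tens_mor (tens M) (flatten fss)).
Proof.
rewrite cod_tens_mor dom_tens_mor dom_gamma cod_gamma -!map_comp map_flatten.
by split=> //; congr tens_ob; apply: eq_map => fs /=; rewrite cod_tens_mor.
Qed.

Lemma iota_natural_composable (f : Mor (lm_cat M)) :
  cod f = dom (lm_iota (cod f)) /\
  cod (lm_iota (dom f)) = dom (tens_mor (tens M) [:: f]).
Proof. by rewrite dom_iota cod_iota dom_tens_mor. Qed.

Lemma gamma_assoc_composable (xsss : seq (seq (seq (Ob (lm_cat M))))) :
  cod (tens_mor (tens M) (map (@lm_gamma M) xsss)) =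
    dom (lm_gamma (map flatten xsss)) /\
  cod (lm_gamma [seq [seq tens_ob (tens M) xs | xs <- xss] | xss <- xsss]) =
    dom (lm_gamma (flatten xsss)).
Proof.
rewrite cod_tens_mor cod_gamma !dom_gamma -!map_comp map_flatten.
by split=> //; congr tens_ob; apply: eq_map => xss /=; rewrite cod_gamma.
Qed.

Lemma gamma_unitl_composable xs :
  cod (lm_iota (tens_ob (tens M) xs)) = dom (lm_gamma [:: xs]).
Proof. by rewrite cod_iota dom_gamma. Qed.

Lemma gamma_unitr_composable xs :
  cod (tens_mor (tens M) (map (@lm_iota M) xs)) =
  dom (lm_gamma [seq [:: x] | x <- xs]).
Proof.
rewrite cod_tens_mor dom_gamma -!map_comp.
by congr tens_ob; apply: eq_map => x /=; rewrite cod_iota.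
Qed.
End Composable.

(* Main.v *)
From mathcomp Require Import all_boot zify.
From Stdlib Require Import FunctionalExtensionality ProofIrrelevance.
From Stdlib Require Import ClassicalEpsilon.
Require Import Defs.

(* A simplex x of the Catalan simplicial set labels its edges by 0 and 1.  A
   subset C of its vertices is sent to the power of A whose exponent is the
   number of 1s on the spine of C, and an inclusion of C in D to the product,
   over the 1s on the spine of C, of tensor products of the 1s on the spine of
   the part of D below them.  Preservation of degeneracies forces one exception:
   where that part of D is a degeneracy of the 1-simplex 1, the tensor product
   of arity one is replaced by the identity functor.

   The 2-cells therefore compose a mixture of tensor products and identity
   functors.  They are obtained by comparing every identity with the unary
   tensor product through iota and then applying gamma, except that identities
   compose strictly.  Associativity, naturality and the two unit laws reduce
   their coherence to that of gamma.

   All labellings in which edges between nonconsecutive vertices carry 1 are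
   simplices.  Hence one can insert edges labelled 0 so as to make any part of D
   nondegenerate without changing arities, and all the tensor products,
   including the unary one, all components of gamma, and iota occur among the
   values of alpha. *)

Set Implicit Arguments.
Unset Strict Implicit.
Unset Printing Implicit Defensive.

(** * Maps over sequences *)

Lemma eq_map_all (T U : Type) (a : pred T) (F G : T -> U) s :
  all a s -> (forall x, a x -> F x = G x) -> map F s = map G s.
Proof. by move=> + FG; elim: s => //= x s IH /andP[/FG -> /IH ->]. Qed.

Lemma eq_map_cond (T U V : Type) (f g : T -> V) (F G : T -> U) s :
  (forall x, f x = g x -> F x = G x) -> map f s = map g s -> map F s = map G s.
Proof. by move=> FG; elim: s => //= x s IH [/FG -> /IH ->]. Qed.

Lemma map_zip (T U V W : Type) (f : T -> V) (g : U -> W) s t :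
  zip (map f s) (map g t) = [seq (f z.1, g z.2) | z <- zip s t].
Proof. by elim: s t => [|x s IH] [|y t] //=; rewrite IH. Qed.

(** * Total composition of arrows *)

(* Junk value: [f] when the arrows are not composable. *)
Definition tcomp (A : category) (g f : Mor A) : Mor A :=
  if excluded_middle_informative (cod f = dom g) is left e then compm g f e
  else f.
Notation "g \c f" := (tcomp g f) (at level 41, right associativity).

Section TotalComp.
Variable A : category.
Implicit Types f g h : Mor A.

Lemma tcompE g f e : compm g f e = g \c f.
Proof.
rewrite /tcomp; case: excluded_middle_informative => // e'.
exact: compm_eq.
Qed.

Lemma dom_tcomp g f : cod f = dom g -> dom (g \c f) = dom f.
Proof. by move=> e; rewrite -tcompE dom_compm. Qed.

Lemma cod_tcomp g f : cod f = dom g -> cod (g \c f) = cod g.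
Proof. by move=> e; rewrite -tcompE cod_compm. Qed.

Lemma tcomp_idl x f : cod f = x -> idm x \c f = f.
Proof.
move=> <-; have e : cod f = dom (idm (cod f)) by rewrite dom_idm.
by rewrite -(tcompE e) compm_idl.
Qed.

Lemma tcomp_idr x f : dom f = x -> f \c idm x = f.
Proof.
move=> <-; have e : cod (idm (dom f)) = dom f by rewrite cod_idm.
by rewrite -(tcompE e) compm_idr.
Qed.

Lemma tcompA h g f : cod f = dom g -> cod g = dom h ->
  h \c g \c f = (h \c g) \c f.
Proof.
move=> e1 e2; rewrite -(tcompE e1) -(tcompE e2).
have e3 : cod (compm g f e1) = dom h by rewrite cod_compm.
have e4 : cod f = dom (compm h g e2) by rewrite dom_compm.
by rewrite -(tcompE e3) -(tcompE e4) compm_assoc.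
Qed.
End TotalComp.

(** * Tuples as lists *)

Section TupleSeq.
Variables (P : category -> Type) (A : category).

(** A tuple over a constant word is read as a plain list, so that tuples whose lengths agree only
    propositionally can be compared. *)
Fixpoint hseq n : hprod P (nseq n A) -> seq (P A) :=
  match n with
  | 0 => fun _ => [::]
  | n'.+1 => fun x => x.1 :: hseq x.2
  end.

(** Confines the transport along an equation of lengths, which [seqhK] removes again. *)
Definition seqh n (s : seq (P A)) (e : size s = n) : hprod P (nseq n A) :=
  eq_rect _ (fun m => hprod P (nseq m A)) (tuple_of s) _ e.

Lemma hlist_hseq n (x : hprod P (nseq n A)) :
  hlist x = map (existT P A) (hseq x).
Proof. by elim: n x => [|n IH] //= x; rewrite IH. Qed.

Lemma map_existT_inj : injective (map (existT P A)).
Proof. by apply: inj_map => x y; exact: inj_pairT2. Qed.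

Lemma hseq_inj n : injective (@hseq n).
Proof. by move=> x y h; apply: hlist_inj; rewrite !hlist_hseq h. Qed.

Lemma size_hseq n (x : hprod P (nseq n A)) : size (hseq x) = n.
Proof. by elim: n x => [|n IH] //= x; rewrite IH. Qed.

Lemma seqhK n s (e : size s = n) : hseq (seqh e) = s.
Proof. by case: n / e => /=; elim: s => //= x s ->. Qed.

Lemma hseqK n (x : hprod P (nseq n A)) (e : size (hseq x) = n) : seqh e = x.
Proof. by apply: hseq_inj; rewrite seqhK. Qed.
End TupleSeq.

Lemma hseq_hmap (P Q : category -> Type) (f : forall B, P B -> Q B) A n
  (x : hprod P (nseq n A)) : hseq (hmap f x) = map (@f A) (hseq x).
Proof. by elim: n x => [|n IH] //= x; rewrite IH. Qed.

(** Acting on a pair, it turns componentwise composition of tuples into a map over a [zip]. *)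
Definition zcomp A (h : Mor A * Mor A) : Mor A := h.1 \c h.2.

Lemma hseq_hcomp A n (g f : hprod Mor (nseq n A)) e :
  hseq (hcomp g f e) = map (@zcomp A) (zip (hseq g) (hseq f)).
Proof. by elim: n g f e => [|n IH] //= g f e; rewrite IH tcompE. Qed.

(** * Functoriality of the tensor products in terms of lists *)

Section TensSeq.
Variables (A : category) (T : forall n, functor (pow A n) A).

Lemma Fo_seqh n s (e : size s = n) : Fo (T n) (seqh e) = tens_ob T s.
Proof. by case: n / e. Qed.

Lemma Fm_seqh n s (e : size s = n) : Fm (T n) (seqh e) = tens_mor T s.
Proof. by case: n / e. Qed.

Lemma tens_mor_idm xs : tens_mor T (map idm xs) = idm (tens_ob T xs).
Proof.
have e : size (map idm xs) = size xs by rewrite size_map.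
rewrite -(Fm_seqh e) /tens_ob -Fm_idm; congr Fm; apply: hseq_inj.
by rewrite seqhK hseq_hmap -[in LHS](seqhK (erefl (size xs))).
Qed.

(* The pairs in [hs] are composable: [hs = zip gs fs], [map cod fs = map dom gs]. *)
Lemma tens_mor_zcomp (hs : seq (Mor A * Mor A)) :
  map (fun h => cod h.2) hs = map (fun h => dom h.1) hs ->
  tens_mor T (map (@zcomp A) hs) =
  tens_mor T (unzip1 hs) \c tens_mor T (unzip2 hs).
Proof.
move=> hc.
have e1 : size (unzip1 hs) = size hs by rewrite size_map.
have e2 : size (unzip2 hs) = size hs by rewrite size_map.
have e3 : size (map (@zcomp A) hs) = size hs by rewrite size_map.
have e : hmap (@cod) (seqh e2) = hmap (@dom) (seqh e1).
  by apply: hseq_inj; rewrite !hseq_hmap !seqhK -!map_comp.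
have e' : cod (Fm (T (size hs)) (seqh e2)) = dom (Fm (T (size hs)) (seqh e1)).
  by rewrite cod_Fm dom_Fm; congr Fo.
rewrite -(Fm_seqh e1) -(Fm_seqh e2) -(Fm_seqh e3) -(tcompE e').
rewrite -(@Fm_compm _ _ (T (size hs)) _ _ e e'); congr Fm; apply: hseq_inj.
by rewrite seqhK hseq_hcomp !seqhK zip_unzip.
Qed.
End TensSeq.

(** * Operations: tensor products and the identity functor *)

Section Operations.
Variable M : lax_monoidal_category.
Local Notation A := (lm_cat M).
Local Notation T := (tens M).
Local Notation gam := (@lm_gamma M).
Local Notation iot := (@lm_iota M).

Lemma tgamma_natural fss :
  gam (map (map cod) fss) \c tens_mor T (map (tens_mor T) fss) =
  tens_mor T (flatten fss) \c gam (map (map dom) fss).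
Proof.
have [e e'] := gamma_natural_composable fss.
by rewrite -(tcompE e) -(tcompE e') gamma_natural.
Qed.

Lemma tiota_natural (f : Mor A) :
  iot (cod f) \c f = tens_mor T [:: f] \c iot (dom f).
Proof.
have [e e'] := iota_natural_composable f.
by rewrite -(tcompE e) -(tcompE e') iota_natural.
Qed.

Lemma tgamma_assoc xsss :
  gam (map flatten xsss) \c tens_mor T (map gam xsss) =
  gam (flatten xsss) \c gam (map (map (tens_ob T)) xsss).
Proof.
have [e e'] := gamma_assoc_composable xsss.
by rewrite -(tcompE e) -(tcompE e') gamma_assoc.
Qed.

Lemma tgamma_unitl xs :
  gam [:: xs] \c iot (tens_ob T xs) = idm (tens_ob T xs).
Proof. by rewrite -(tcompE (gamma_unitl_composable xs)) gamma_unitl. Qed.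

Lemma tgamma_unitr xs :
  gam [seq [:: x] | x <- xs] \c tens_mor T (map iot xs) = idm (tens_ob T xs).
Proof. by rewrite -(tcompE (gamma_unitr_composable xs)) gamma_unitr. Qed.

(* The flag [true] on a list of length one stands for the identity functor, and
   everything else for the tensor product. *)
Definition op_ob (b : bool) (xs : seq (Ob A)) : Ob A :=
  match b, xs with true, [:: x] => x | _, _ => tens_ob T xs end.
Definition op_mor (b : bool) (fs : seq (Mor A)) : Mor A :=
  match b, fs with true, [:: f] => f | _, _ => tens_mor T fs end.
(** Component of the comparison from an operation to the tensor product of the same arity: [iota] at
    the identity functor, an identity arrow elsewhere. *)
Definition op_tens (b : bool) (xs : seq (Ob A)) : Mor A :=
  match b, xs with true, [:: x] => iot x | _, _ => idm (tens_ob T xs) end.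

Lemma dom_op_mor b fs : dom (op_mor b fs) = op_ob b (map dom fs).
Proof. by case: b fs => [] [|f [|g fs]] //; apply: dom_tens_mor. Qed.

Lemma cod_op_mor b fs : cod (op_mor b fs) = op_ob b (map cod fs).
Proof. by case: b fs => [] [|f [|g fs]] //; apply: cod_tens_mor. Qed.

Lemma op_mor_idm b xs : op_mor b (map idm xs) = idm (op_ob b xs).
Proof. by case: b xs => [] [|x [|y xs]] //; apply: tens_mor_idm. Qed.

Lemma op_mor_zcomp b (hs : seq (Mor A * Mor A)) :
  map (fun h => cod h.2) hs = map (fun h => dom h.1) hs ->
  op_mor b (map (@zcomp A) hs) = op_mor b (unzip1 hs) \c op_mor b (unzip2 hs).
Proof. by case: b hs => [] [|h [|h' hs]] // hc; apply: tens_mor_zcomp. Qed.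

Lemma dom_op_tens b xs : dom (op_tens b xs) = op_ob b xs.
Proof. by case: b xs => [] [|x [|y xs]] //=; rewrite ?dom_idm ?dom_iota. Qed.

Lemma cod_op_tens b xs : cod (op_tens b xs) = tens_ob T xs.
Proof. by case: b xs => [] [|x [|y xs]] //=; rewrite ?cod_idm ?cod_iota. Qed.

Lemma op_tens_natural b fs :
  op_tens b (map cod fs) \c op_mor b fs =
  tens_mor T fs \c op_tens b (map dom fs).
Proof.
have idn : idm (tens_ob T (map cod fs)) \c tens_mor T fs =
           tens_mor T fs \c idm (tens_ob T (map dom fs)).
  by rewrite tcomp_idl ?cod_tens_mor // tcomp_idr ?dom_tens_mor.
by case: b fs idn => [] [|f [|g fs]] // _; apply: tiota_natural.
Qed.

Local Notation block S := (seq (bool * seq S)).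

Definition op_obs (z : block (Ob A)) : seq (Ob A) :=
  [seq op_ob y.1 y.2 | y <- z].
Definition op_tenss (z : block (Ob A)) : seq (Mor A) :=
  [seq op_tens y.1 y.2 | y <- z].

(** The outer operation, then each inner one, is compared with a tensor product; gamma then composes
    these. *)
Definition comparison (b : bool) (z : block (Ob A)) : Mor A :=
  gam (unzip2 z) \c tens_mor T (op_tenss z) \c op_tens b (op_obs z).

(* The arrow from the composite of the operation [b] with the operations in [z]
   to the operation [b']. *)
Definition two_cell (b' b : bool) (z : block (Ob A)) : Mor A :=
  match b', flatten (unzip2 z) with
  | true, [:: x] => idm x
  | _, _ => comparison b z
  end.

(** The last condition excludes 2-cells from a composite involving a tensor product to the identity
    functor, which a lax monoidal structure does not supply. *)
Definition block_wf S (b' b : bool) (z : block S) :=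
  [&& b ==> (size z == 1), all (fun y => y.1 ==> (size y.2 == 1)) z &
      b' ==> b && all fst z].

(** The dichotomy behind the case analyses below: either the target is a tensor product and the
    2-cell is [comparison], or everything in sight is the identity functor. *)
Lemma block_wfP S b' b (z : block S) : block_wf b' b z ->
  b' = false \/ exists x, [/\ b' = true, b = true & z = [:: (true, [:: x])]].
Proof.
case: b' => /and3P[]; last by left.
case: b => // h1 h2 h3; right; move: h1 h2 h3.
by case: z => [|[[] [|x [|? ?]]] [|? ?]] //= _ _ _; exists x.
Qed.

Lemma op_tenss_composable z :
  cod (tens_mor T (op_tenss z)) = dom (gam (unzip2 z)).
Proof.
rewrite cod_tens_mor dom_gamma; congr tens_ob; rewrite -!map_comp.
by apply: eq_map => y; rewrite /= cod_op_tens.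
Qed.

Lemma comparison_composable b z :
  cod (op_tens b (op_obs z)) = dom (tens_mor T (op_tenss z)).
Proof.
rewrite cod_op_tens dom_tens_mor; congr tens_ob; rewrite -!map_comp.
by apply: eq_map => y; rewrite /= dom_op_tens.
Qed.

Lemma dom_comparison b z : dom (comparison b z) = op_ob b (op_obs z).
Proof.
have h := comparison_composable b z; have h' := op_tenss_composable z.
by rewrite dom_tcomp ?cod_tcomp // dom_tcomp // dom_op_tens.
Qed.

Lemma cod_comparison b z : cod (comparison b z) = tens_ob T (flatten (unzip2 z)).
Proof.
have h := comparison_composable b z; have h' := op_tenss_composable z.
by rewrite cod_tcomp ?cod_tcomp // cod_gamma.
Qed.

Lemma dom_two_cell b' b z : block_wf b' b z ->
  dom (two_cell b' b z) = op_ob b (op_obs z).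
Proof.
case/block_wfP=> [->|[x [-> -> ->]]]; first exact: dom_comparison.
by rewrite dom_idm.
Qed.

Lemma cod_two_cell b' b z : block_wf b' b z ->
  cod (two_cell b' b z) = op_ob b' (flatten (unzip2 z)).
Proof.
case/block_wfP=> [->|[x [-> -> ->]]]; first exact: cod_comparison.
by rewrite cod_idm.
Qed.

(** A pasting of three naturality squares: of the outer comparison, of the inner comparisons under
    the tensor product, and of gamma. *)
Lemma comparison_natural b (z : block (Mor A)) :
  comparison b [seq (y.1, map cod y.2) | y <- z] \c
    op_mor b [seq op_mor y.1 y.2 | y <- z] =
  tens_mor T (flatten (unzip2 z)) \c
    comparison b [seq (y.1, map dom y.2) | y <- z].
Proof.
set zc := [seq (y.1, map cod y.2) | y <- z].
set zd := [seq (y.1, map dom y.2) | y <- z].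
have uc : unzip2 zc = map (map cod) (unzip2 z).
  by rewrite /unzip2 -!map_comp.
have ud : unzip2 zd = map (map dom) (unzip2 z).
  by rewrite /unzip2 -!map_comp.
have oc : op_obs zc = map cod [seq op_mor y.1 y.2 | y <- z].
  by rewrite /op_obs -!map_comp; apply: eq_map => y /=; rewrite cod_op_mor.
have od : op_obs zd = map dom [seq op_mor y.1 y.2 | y <- z].
  by rewrite /op_obs -!map_comp; apply: eq_map => y /=; rewrite dom_op_mor.
set F := [seq op_mor y.1 y.2 | y <- z] in oc od *.
have h1 : cod (op_mor b F) = dom (op_tens b (op_obs zc)).
  by rewrite dom_op_tens oc cod_op_mor.
have h2 := comparison_composable b zc; have h3 := op_tenss_composable zc.
have h4 := comparison_composable b zd; have h5 := op_tenss_composable zd.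
have h6 : cod (op_tens b (op_obs zd)) = dom (tens_mor T F).
  by rewrite cod_op_tens dom_tens_mor od.
have h7 : cod (tens_mor T F) = dom (tens_mor T (op_tenss zc)).
  by rewrite -h2 cod_op_tens cod_tens_mor oc.
have hG1 : cod (gam (unzip2 zd)) = dom (tens_mor T (flatten (unzip2 z))).
  by rewrite cod_gamma dom_tens_mor ud map_flatten.
have hG2 : cod (tens_mor T (map (tens_mor T) (unzip2 z))) = dom (gam (unzip2 zc)).
  rewrite cod_tens_mor dom_gamma uc -!map_comp; congr tens_ob.
  by apply: eq_map => y /=; rewrite cod_tens_mor.
have hG3 : cod (tens_mor T (op_tenss zd)) =
    dom (tens_mor T (map (tens_mor T) (unzip2 z))).
  rewrite cod_tens_mor dom_tens_mor -!map_comp; congr tens_ob.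
  by apply: eq_map => y /=; rewrite cod_op_tens dom_tens_mor.
have sq : tens_mor T (op_tenss zc) \c tens_mor T F =
    tens_mor T (map (tens_mor T) (unzip2 z)) \c tens_mor T (op_tenss zd).
  (* Both sides are tensor products of composable pairs, so functoriality reduces the square to
     [op_tens_natural] in each entry. *)
  pose hs1 := [seq (op_tens y.1 (map cod y.2), op_mor y.1 y.2) | y <- z].
  pose hs2 := [seq (tens_mor T y.2, op_tens y.1 (map dom y.2)) | y <- z].
  have -> : op_tenss zc = unzip1 hs1 by rewrite /op_tenss /unzip1 -!map_comp.
  have -> : F = unzip2 hs1 by rewrite /unzip2 -!map_comp.
  have -> : map (tens_mor T) (unzip2 z) = unzip1 hs2.
    by rewrite /unzip2 /unzip1 -!map_comp.
  have -> : op_tenss zd = unzip2 hs2 by rewrite /op_tenss /unzip2 -!map_comp.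
  rewrite -!tens_mor_zcomp; last 2 first.
  - rewrite -!map_comp; apply: eq_map => y /=.
    by rewrite cod_op_tens dom_tens_mor.
  - by rewrite -!map_comp; apply: eq_map => y /=; rewrite cod_op_mor dom_op_tens.
  rewrite -!map_comp; congr tens_mor; apply: eq_map => y.
  exact: op_tens_natural.
rewrite /comparison -!tcompA ?cod_tcomp ?dom_tcomp //.
rewrite oc op_tens_natural -od.
rewrite [X in _ \c X]tcompA // sq -tcompA // tcompA ?cod_tcomp //.
rewrite uc tgamma_natural -ud -tcompA // ?cod_tcomp //.
Qed.

(** If the target is the identity functor, the claim is that gamma after tensored [iota] after
    [iota] equals [iota], which is the right unit law in arity one. *)
Lemma op_tens_two_cell b' b z : block_wf b' b z ->
  op_tens b' (flatten (unzip2 z)) \c two_cell b' b z = comparison b z.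
Proof.
case/block_wfP=> [->|[x [-> -> ->]]].
  by rewrite /= tcomp_idl // cod_comparison.
rewrite /two_cell /comparison /= tcomp_idr ?dom_iota //.
rewrite tcompA ?(tgamma_unitr [:: x]) ?tcomp_idl //.
- by rewrite cod_iota.
- by rewrite cod_iota dom_tens_mor /= dom_iota.
- by rewrite cod_tens_mor dom_gamma /= cod_iota.
Qed.

Lemma two_cell_natural b' b (z : block (Mor A)) : block_wf b' b z ->
  two_cell b' b [seq (y.1, map cod y.2) | y <- z] \c
    op_mor b [seq op_mor y.1 y.2 | y <- z] =
  op_mor b' (flatten (unzip2 z)) \c
    two_cell b' b [seq (y.1, map dom y.2) | y <- z].
Proof.
case/block_wfP=> [->|[f [-> -> ->]]]; first exact: comparison_natural.
by rewrite /= tcomp_idl ?tcomp_idr.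
Qed.

(** Apart from the unary identity, where the 2-cell is an identity by definition, this is the right
    unit law of gamma. *)
Lemma two_cell_idl b xs :
  two_cell b b [seq (true, [:: x]) | x <- xs] = idm (op_ob b xs).
Proof.
suff nonunary : op_tens b xs = idm (tens_ob T xs) ->
    comparison b [seq (true, [:: x]) | x <- xs] = idm (tens_ob T xs).
  case: b xs nonunary => [] [|x [|y xs]] //= h; exact: h.
move=> ht; rewrite /comparison.
have -> : op_obs [seq (true, [:: x]) | x <- xs] = xs.
  by rewrite /op_obs -map_comp map_id.
have -> : op_tenss [seq (true, [:: x]) | x <- xs] = map iot xs.
  by rewrite /op_tenss -map_comp.
rewrite ht tcomp_idr; last first.
  by rewrite dom_tens_mor -map_comp (eq_map (@dom_iota M)) map_id.
by rewrite /unzip2 -map_comp; exact: tgamma_unitr.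
Qed.

(** Here the outer operation is the identity functor, so the left unit law of gamma applies. *)
Lemma two_cell_idr b xs : two_cell b true [:: (b, xs)] = idm (op_ob b xs).
Proof.
suff nonunary : op_tens b xs = idm (tens_ob T xs) ->
    op_ob b xs = tens_ob T xs ->
    comparison true [:: (b, xs)] = idm (tens_ob T xs).
  by case: b xs nonunary => [] [|x [|y xs]] //= h; rewrite /two_cell /= ?cats0 h.
move=> ht ho; rewrite /comparison /= ht ho.
have -> : [:: idm (tens_ob T xs)] = map idm [:: tens_ob T xs] by [].
rewrite tens_mor_idm tcomp_idl ?cod_iota //; exact: tgamma_unitl.
Qed.

(* Both sides are [gamma] for the threefold composite after a comparison; when
   the target operation is the identity, so are all the others. *)
Lemma two_cell_coherence bil bjl bkl
    (v : seq (bool * (bool * block (Ob A)))) :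
  let zjk := [seq (y.2.1, op_obs y.2.2) | y <- v] in
  let zij := flatten [seq y.2.2 | y <- v] in
  let zik := [seq (y.1, flatten (unzip2 y.2.2)) | y <- v] in
  block_wf bjl bkl zjk -> block_wf bil bjl zij -> block_wf bil bkl zik ->
  all (fun y => block_wf y.1 y.2.1 y.2.2) v ->
  two_cell bil bjl zij \c two_cell bjl bkl zjk =
  two_cell bil bkl zik \c op_mor bkl [seq two_cell y.1 y.2.1 y.2.2 | y <- v].
Proof.
move=> zjk zij zik wjl wijl wikl wv.
have ozij : op_obs zij = flatten (unzip2 zjk).
  by rewrite /op_obs map_flatten /unzip2 -!map_comp.
case: (block_wfP wikl) => [e|[x [e1 e2 e3]]]; last first.
  move: wijl wjl wv e3; rewrite e1 e2 /zjk /zij /zik.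
  case/block_wfP=> // -[x' [_ -> ex']].
  case: v ex' {zjk zij zik wikl ozij} => [|[a [c z]] [|//]] //=.
  rewrite cats0 => -> /block_wfP[//|[x'' [_ _ [-> /= _]]]] + [-> ->] //=.
rewrite e in wijl wikl *.
set V := [seq two_cell y.1 y.2.1 y.2.2 | y <- v].
rewrite {1 3}/two_cell /= {1}/comparison ozij.
have domV : map dom V = op_obs zjk.
  rewrite /V /op_obs /zjk -!map_comp.
  by apply: eq_map_all wv _ => y; exact: dom_two_cell.
have codV : map cod V = op_obs zik.
  rewrite /V /op_obs /zik -!map_comp.
  by apply: eq_map_all wv _ => y; exact: cod_two_cell.
pose G := [seq gam (unzip2 y.2.2) | y <- v].
pose S := [seq op_tenss y.2.2 | y <- v].
pose TS := [seq tens_mor T (op_tenss y.2.2) | y <- v].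
have uzij : unzip2 zij = flatten [seq unzip2 y.2.2 | y <- v].
  by rewrite /unzip2 map_flatten -!map_comp.
have uzik : unzip2 zik = map flatten [seq unzip2 y.2.2 | y <- v].
  by rewrite /unzip2 -!map_comp.
have szij : op_tenss zij = flatten S.
  by rewrite /op_tenss map_flatten -!map_comp.
pose Y := [seq unzip2 y.2.2 | y <- v].
have Sdom : map (map dom) S = unzip2 zjk.
  rewrite /S /unzip2 -!map_comp; apply: eq_map => y /=.
  rewrite /op_tenss /op_obs -!map_comp; apply: eq_map => ? /=.
  exact: dom_op_tens.
have Scod : map (map cod) S = map (map (tens_ob T)) Y.
  rewrite /S /Y /unzip2 -!map_comp; apply: eq_map => y /=.
  by rewrite /op_tenss -!map_comp; apply: eq_map => ? /=; rewrite cod_op_tens.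
have TSE : TS = map (tens_mor T) S by rewrite /TS -map_comp.
have GE : G = map gam Y by rewrite /G -map_comp.
have nat := tgamma_natural S.
have ass := tgamma_assoc Y.
rewrite -/Y -TSE -szij Sdom Scod -GE in uzij uzik nat ass.
have c1 : cod (two_cell bjl bkl zjk) = dom (op_tens bjl (flatten (unzip2 zjk))).
  by rewrite cod_two_cell // dom_op_tens.
have c2 := comparison_composable bjl zij; rewrite ozij in c2.
have c3 := op_tenss_composable zij.
have c4 := op_tenss_composable zjk.
have c5 := comparison_composable bkl zjk.
have c6 : cod (gam (unzip2 zjk)) = dom (tens_mor T (op_tenss zij)).
  by rewrite -c2 cod_gamma cod_op_tens.
have c7 : cod (tens_mor T TS) = dom (gam (map (map (tens_ob T)) Y)).
  rewrite cod_tens_mor dom_gamma TSE -Scod -!map_comp; congr tens_ob.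
  by apply: eq_map => y /=; rewrite cod_tens_mor.
have c8 : cod (tens_mor T (op_tenss zjk)) = dom (tens_mor T TS).
  rewrite c4 -Sdom dom_gamma dom_tens_mor TSE -!map_comp; congr tens_ob.
  by apply: eq_map => y /=; rewrite dom_tens_mor.
have c9 : cod (gam (map (map (tens_ob T)) Y)) = dom (gam (flatten Y)).
  by rewrite cod_gamma dom_gamma map_flatten.
have c10 : cod (tens_mor T G) = dom (gam (map flatten Y)).
  rewrite cod_tens_mor dom_gamma GE -!map_comp; congr tens_ob.
  by apply: eq_map => y /=; rewrite cod_gamma.
have c11 : cod (tens_mor T TS) = dom (tens_mor T G).
  rewrite c7 dom_gamma dom_tens_mor GE -!map_comp; congr tens_ob.
  by apply: eq_map => y /=; rewrite dom_gamma.
have c12 : cod (op_mor bkl V) = dom (op_tens bkl (op_obs zik)).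
  by rewrite cod_op_mor codV dom_op_tens.
have c13 := comparison_composable bkl zik.
have c14 := op_tenss_composable zik.
have c15 : cod (tens_mor T V) = dom (tens_mor T (op_tenss zik)).
  by rewrite -c13 cod_op_tens cod_tens_mor codV.
have c16 : cod (op_tens bkl (op_obs zjk)) = dom (tens_mor T V).
  by rewrite cod_op_tens dom_tens_mor domV.
(* In each entry [op_tens_two_cell] turns the compared 2-cell into a [comparison], whose three
   factors are then tensored separately. *)
have inner : tens_mor T (op_tenss zik) \c tens_mor T V =
    tens_mor T G \c tens_mor T TS \c tens_mor T (op_tenss zjk).
  pose h1 := [seq (op_tens y.1 (flatten (unzip2 y.2.2)),
                   two_cell y.1 y.2.1 y.2.2) | y <- v].
  pose h2 := [seq (tens_mor T (op_tenss y.2.2),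
                   op_tens y.2.1 (op_obs y.2.2)) | y <- v].
  pose h3 := [seq (gam (unzip2 y.2.2), tens_mor T (op_tenss y.2.2) \c
                   op_tens y.2.1 (op_obs y.2.2)) | y <- v].
  have -> : op_tenss zik = unzip1 h1.
    by rewrite /op_tenss /unzip1 -!map_comp.
  have -> : V = unzip2 h1 by rewrite /unzip2 -!map_comp.
  have -> : G = unzip1 h3 by rewrite /unzip1 -!map_comp.
  have -> : op_tenss zjk = unzip2 h2.
    by rewrite /op_tenss /unzip2 -!map_comp.
  have -> : TS = unzip1 h2 by rewrite /unzip1 -!map_comp.
  have e1 : map (fun h => cod h.2) h1 = map (fun h => dom h.1) h1.
    rewrite -!map_comp; apply: eq_map_all wv _ => y wy /=.
    by rewrite cod_two_cell // dom_op_tens.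
  have e2 : map (fun h => cod h.2) h2 = map (fun h => dom h.1) h2.
    rewrite -!map_comp; apply: eq_map => y /=.
    by rewrite comparison_composable.
  have e3 : map (fun h => cod h.2) h3 = map (fun h => dom h.1) h3.
    rewrite -!map_comp; apply: eq_map => y /=.
    by rewrite cod_tcomp ?op_tenss_composable // comparison_composable.
  have h23 : map (@zcomp A) h2 = unzip2 h3 by rewrite /unzip2 -!map_comp.
  rewrite -!tens_mor_zcomp // h23 -!tens_mor_zcomp // -!map_comp.
  congr tens_mor; apply: eq_map_all wv _ => y wy.
  exact: op_tens_two_cell.
(* The outer comparison of the later 2-cell is absorbed into the earlier one by
   [op_tens_two_cell]. *)
transitivity (gam (unzip2 zij) \c tens_mor T (op_tenss zij) \c
              comparison bkl zjk).
  by rewrite -(op_tens_two_cell wjl) -!tcompA ?cod_tcomp ?dom_tcomp.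
have cX : cod (tens_mor T (op_tenss zjk) \c op_tens bkl (op_obs zjk)) =
          dom (tens_mor T TS) by rewrite cod_tcomp.
set X := op_tens bkl (op_obs zjk) in cX c5 c16 *.
(* Naturality of gamma moves the comparisons of the innermost operations before the first gamma; the
   two adjacent gammas are then rearranged by associativity. *)
transitivity (gam (unzip2 zik) \c (tens_mor T G \c tens_mor T TS \c
                 tens_mor T (op_tenss zjk)) \c X).
  rewrite /comparison [X in _ \c X]tcompA ?cod_tcomp //.
  rewrite -nat -tcompA //.
  rewrite (@tcompA _ (gam (unzip2 zij))) ?uzij ?cod_tcomp //.
  rewrite -ass uzik.
  by rewrite -!tcompA ?cod_tcomp ?dom_tcomp.
rewrite -inner /comparison -!tcompA ?cod_tcomp ?dom_tcomp //.
by rewrite -codV op_tens_natural domV.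
Qed.
End Operations.

(** * Lists of operations *)

Lemma zip_zipr (S T U : Type) (a : seq S) (b : seq T) (d : seq U) :
  size a = size b -> zip b d = [seq (q.1.2, q.2) | q <- zip (zip a b) d].
Proof.
by elim: a b d => [|x a IH] [|y b] [|z d] //= [h]; rewrite -IH.
Qed.

Lemma zip_zipl (S T U : Type) (a : seq S) (b : seq T) (d : seq U) :
  size a = size b -> zip a d = [seq (q.1.1, q.2) | q <- zip (zip a b) d].
Proof.
by elim: a b d => [|x a IH] [|y b] [|z d] //= [h]; rewrite -IH.
Qed.

Lemma zip_mapr (S T U : Type) (g : T -> U) (a : seq S) (d : seq T) :
  zip a (map g d) = [seq (z.1, g z.2) | z <- zip a d].
Proof. by rewrite -[a in LHS]map_id map_zip. Qed.

Lemma reshape_flatten_eq (T : Type) (ss : seq (seq T)) (sh : seq nat) s :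
  shape ss = sh -> flatten ss = s -> reshape sh s = ss.
Proof. by move=> <- <-; rewrite flattenK. Qed.

(** A list of lists is determined by its shape and its flattening, so only these two are
    compared. *)
Lemma reshape_sumn (T : Type) (s2 s1 : seq nat) (xs : seq T) :
  sumn s2 = size s1 -> sumn s1 = size xs ->
  reshape (map sumn (reshape s2 s1)) xs =
  map flatten (reshape s2 (reshape s1 xs)).
Proof.
move=> h2 h1; apply: reshape_flatten_eq.
  have sh1 : shape (reshape s1 xs) = s1 by rewrite reshapeKl ?h1.
  rewrite -[in RHS]sh1 /shape -map_reshape -!map_comp.
  by apply: eq_map => ys; exact: size_flatten.
have flatten2 (U : Type) (xss : seq (seq (seq U))) :
    flatten (map flatten xss) = flatten (flatten xss).
  by elim: xss => //= xs' xss ->; rewrite flatten_cat.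
by rewrite flatten2 !reshapeKr ?size_reshape ?h1 ?h2.
Qed.

(* Flags and arities; the flag is [true] for the identity functor and [false]
   for a tensor product. *)
Definition ops := seq (bool * nat).

(** Each flag is paired with the consecutive block of arguments that its operation consumes. *)
Definition dec T (o : ops) (xs : seq T) : seq (bool * seq T) :=
  zip (unzip1 o) (reshape (unzip2 o) xs).

Definition ops_wf (o : ops) := all (fun y => y.1 ==> (y.2 == 1)) o.

(* [o3] is the composite of [o2] with [o1], except that identity functors may
   compose to the tensor product of arity one. *)
Definition ops_le (o3 o2 o1 : ops) :=
  (unzip2 o3 == map sumn (reshape (unzip2 o2) (unzip2 o1))) &&
  all (fun w => w.1 ==> w.2.1 && all id w.2.2)
      (zip (unzip1 o3) (dec o2 (unzip1 o1))).

(** An entry [(b', (b, z))] consists of the three arguments of one [two_cell]: target flag, outer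
    flag, and inner operations with their inputs. *)
Definition blocks T (o3 o2 o1 : ops) (xs : seq T) :=
  zip (unzip1 o3) (dec o2 (dec o1 xs)).

Section Dec.
Variable T : Type.
Implicit Types (o : ops) (xs : seq T).

Lemma size_dec o xs : size (dec o xs) = size o.
Proof. by rewrite size_zip size_reshape !size_map minnn. Qed.

Lemma unzip1_dec o xs : unzip1 (dec o xs) = unzip1 o.
Proof. by rewrite unzip1_zip // size_reshape !size_map. Qed.

Lemma unzip2_dec o xs : unzip2 (dec o xs) = reshape (unzip2 o) xs.
Proof. by rewrite unzip2_zip // size_reshape !size_map. Qed.

Lemma dec_map (U : Type) (f : T -> U) o xs :
  dec o (map f xs) = [seq (y.1, map f y.2) | y <- dec o xs].
Proof. by rewrite /dec -map_reshape zip_mapr. Qed.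

Lemma all_dec (a : pred T) o xs :
  all a xs -> all (fun y => all a y.2) (dec o xs).
Proof.
elim: o xs => //= -[b k] o IH xs h; rewrite -[xs](cat_take_drop k) all_cat in h.
by case/andP: h => /= -> h; apply: IH.
Qed.

Lemma dec_wf o xs : ops_wf o -> sumn (unzip2 o) = size xs ->
  all (fun y => y.1 ==> (size y.2 == 1)) (dec o xs).
Proof.
elim: o xs => //= -[b k] o IH xs /= /andP[h1 h2] hs.
have hk : k <= size xs by rewrite -hs leq_addr.
rewrite size_takel // h1; apply: IH => //.
by rewrite size_drop -hs addKn.
Qed.

End Dec.

Lemma size_ops_le o3 o2 o1 : ops_le o3 o2 o1 -> size o3 = size o2.
Proof.
by case/andP=> /eqP/(congr1 size); rewrite !size_map size_reshape size_map.
Qed.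

Section Blocks.
Variable T : Type.
Implicit Types (o : ops) (xs : seq T).

Lemma blocks2 o3 o2 o1 xs : ops_le o3 o2 o1 ->
  unzip2 (blocks o3 o2 o1 xs) = dec o2 (dec o1 xs).
Proof.
by move=> h; apply: unzip2_zip; rewrite size_dec size_map (size_ops_le h).
Qed.

Lemma dec_blocks o3 o2 o1 xs : ops_le o3 o2 o1 ->
  sumn (unzip2 o2) = size o1 -> sumn (unzip2 o1) = size xs ->
  dec o3 xs = [seq (w.1, flatten (unzip2 w.2.2)) | w <- blocks o3 o2 o1 xs].
Proof.
move=> le h2 h1; have [/eqP e _] := andP le.
rewrite {1}/dec e reshape_sumn ?size_map //.
have -> : map flatten (reshape (unzip2 o2) (reshape (unzip2 o1) xs)) =
    [seq flatten (unzip2 y.2) | y <- dec o2 (dec o1 xs)].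
  rewrite -[reshape (unzip2 o1) xs]unzip2_dec -map_reshape -unzip2_dec.
  by rewrite -!map_comp.
by rewrite zip_mapr.
Qed.

(** Splits the conditions on whole lists into one [block_wf] per entry, which lets facts about a
    single [two_cell] be lifted to lists. *)
Lemma blocks_wf o3 o2 o1 xs : ops_le o3 o2 o1 -> ops_wf o2 -> ops_wf o1 ->
  sumn (unzip2 o2) = size o1 -> sumn (unzip2 o1) = size xs ->
  all (fun w => block_wf w.1 w.2.1 w.2.2) (blocks o3 o2 o1 xs).
Proof.
move=> le w2 w1 h2 h1; have [_ fl] := andP le.
have d2 : all (fun y => y.1 ==> (size y.2 == 1)) (dec o2 (dec o1 xs)).
  by apply: dec_wf; rewrite // size_dec.
have d1 := all_dec o2 (dec_wf w1 h1).
rewrite -(unzip1_dec o1 xs) dec_map zip_mapr all_map in fl.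
rewrite -!(blocks2 _ le) !all_map in d1 d2.
move: fl d1 d2; rewrite -/(blocks o3 o2 o1 xs) => fl d1 d2.
have := conj fl (conj d1 d2) => {fl d1 d2}.
elim: (blocks _ _ _ _) => //= w s IH [/andP[f fs] [/andP[e es] /andP[d ds]]].
rewrite IH // andbT /block_wf d e /=.
by rewrite /= all_map in f.
Qed.
End Blocks.

Lemma blocks_map (S U : Type) (f : S -> U) o3 o2 o1 xs :
  blocks o3 o2 o1 (map f xs) =
  [seq (w.1, (w.2.1, [seq (y.1, map f y.2) | y <- w.2.2]))
     | w <- blocks o3 o2 o1 xs].
Proof. by rewrite /blocks !dec_map zip_mapr. Qed.

(** * Functors and 2-cells between powers, given by lists of operations *)

Section ApplyOps.
Variable M : lax_monoidal_category.
Local Notation A := (lm_cat M).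
Implicit Types (o : ops) (xs : seq (Ob A)) (fs : seq (Mor A)).

Definition ap_ob o xs := [seq op_ob y.1 y.2 | y <- dec o xs].
Definition ap_mor o fs := [seq op_mor y.1 y.2 | y <- dec o fs].
Definition ap_two o3 o2 o1 xs :=
  [seq two_cell w.1 w.2.1 w.2.2 | w <- blocks o3 o2 o1 xs].

Lemma size_ap_ob o xs : size (ap_ob o xs) = size o.
Proof. by rewrite size_map size_dec. Qed.

Lemma size_ap_mor o fs : size (ap_mor o fs) = size o.
Proof. by rewrite size_map size_dec. Qed.

Lemma dom_ap_mor o fs : map dom (ap_mor o fs) = ap_ob o (map dom fs).
Proof.
rewrite /ap_ob dec_map -!map_comp; apply: eq_map => y /=.
exact: dom_op_mor.
Qed.

Lemma cod_ap_mor o fs : map cod (ap_mor o fs) = ap_ob o (map cod fs).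
Proof.
rewrite /ap_ob dec_map -!map_comp; apply: eq_map => y /=.
exact: cod_op_mor.
Qed.

Lemma ap_mor_idm o xs : ap_mor o (map idm xs) = map idm (ap_ob o xs).
Proof.
rewrite /ap_mor dec_map -!map_comp; apply: eq_map => y /=.
exact: op_mor_idm.
Qed.

Lemma ap_mor_zcomp o gs fs : map cod fs = map dom gs ->
  ap_mor o (map (@zcomp A) (zip gs fs)) =
  map (@zcomp A) (zip (ap_mor o gs) (ap_mor o fs)).
Proof.
move=> h; have sz : size gs = size fs.
  by move/(congr1 size): h; rewrite !size_map.
have [hs eg ef] : exists2 hs, gs = unzip1 hs & fs = unzip2 hs.
  by exists (zip gs fs); rewrite ?unzip1_zip ?unzip2_zip ?sz.
subst gs fs; rewrite zip_unzip => {sz}.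
rewrite /ap_mor !dec_map -!map_comp map_zip -map_comp.
have : dec o (map (fun h => cod h.2) hs) = dec o (map (fun h => dom h.1) hs).
  by congr dec; rewrite /unzip1 /unzip2 -!map_comp in h.
rewrite !dec_map.
have -> : zip (dec o hs) (dec o hs) = [seq (y, y) | y <- dec o hs].
  by elim: (dec o hs) => //= y s ->.
rewrite -map_comp; apply: eq_map_cond => y /= [].
exact: op_mor_zcomp.
Qed.

Section TwoCells.
Variables o3 o2 o1 : ops.
Hypotheses (le : ops_le o3 o2 o1) (w2 : ops_wf o2) (w1 : ops_wf o1).
Hypothesis s2 : sumn (unzip2 o2) = size o1.

Lemma size_ap_two xs : size (ap_two o3 o2 o1 xs) = size o3.
Proof.
by rewrite size_map size_zip size_dec size_map (size_ops_le le) minnn.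
Qed.

Lemma ap_ob_ap_ob xs : ap_ob o2 (ap_ob o1 xs) =
  [seq op_ob w.2.1 (op_obs w.2.2) | w <- blocks o3 o2 o1 xs].
Proof.
by rewrite /ap_ob dec_map -(blocks2 xs le) -!map_comp.
Qed.

Lemma ap_mor_ap_mor fs : ap_mor o2 (ap_mor o1 fs) =
  [seq op_mor w.2.1 [seq op_mor y.1 y.2 | y <- w.2.2]
     | w <- blocks o3 o2 o1 fs].
Proof.
by rewrite /ap_mor dec_map -(blocks2 fs le) -!map_comp.
Qed.

Lemma dom_ap_two xs : sumn (unzip2 o1) = size xs ->
  map dom (ap_two o3 o2 o1 xs) = ap_ob o2 (ap_ob o1 xs).
Proof.
move=> s1; rewrite ap_ob_ap_ob /ap_two -map_comp.
apply: eq_map_all (blocks_wf le w2 w1 s2 s1) _ => w; exact: dom_two_cell.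
Qed.

Lemma cod_ap_two xs : sumn (unzip2 o1) = size xs ->
  map cod (ap_two o3 o2 o1 xs) = ap_ob o3 xs.
Proof.
move=> s1; rewrite /ap_ob (dec_blocks le s2 s1) /ap_two -!map_comp.
apply: eq_map_all (blocks_wf le w2 w1 s2 s1) _ => w; exact: cod_two_cell.
Qed.

Lemma ap_two_natural fs : sumn (unzip2 o1) = size fs ->
  map (@zcomp A) (zip (ap_two o3 o2 o1 (map cod fs)) (ap_mor o2 (ap_mor o1 fs))) =
  map (@zcomp A) (zip (ap_mor o3 fs) (ap_two o3 o2 o1 (map dom fs))).
Proof.
move=> s1; rewrite ap_mor_ap_mor /ap_mor (dec_blocks le s2 s1) /ap_two.
rewrite !blocks_map -!map_comp !map_zip -!map_comp.
have -> (s : seq (bool * (bool * seq (bool * seq (Mor A))))) :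
  zip s s = [seq (w, w) | w <- s] by elim: s => //= w s ->.
rewrite -!map_comp.
apply: eq_map_all (blocks_wf le w2 w1 s2 s1) _ => w; exact: two_cell_natural.
Qed.
End TwoCells.
End ApplyOps.

Lemma dec_nseq T n (xs : seq T) : size xs = n ->
  dec (nseq n (true, 1)) xs = [seq (true, [:: x]) | x <- xs].
Proof.
by move=> <-; elim: xs => //= x xs IH; rewrite /dec /= take0 drop0 -IH.
Qed.

Lemma zip_zipA (S T U : Type) (a : seq S) (b : seq T) (d : seq U) :
  zip a (zip b d) = [seq (q.1.1, (q.1.2, q.2)) | q <- zip (zip a b) d].
Proof. by elim: a b d => [|x a IH] [|y b] [|z d] //=; rewrite -IH. Qed.

(** * Unit and coherence laws for lists of operations *)

Section Coherence.
Variable M : lax_monoidal_category.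
Local Notation A := (lm_cat M).
Implicit Types (o : ops) (xs : seq (Ob A)).

Lemma ap_ob_nseq n xs : size xs = n -> ap_ob (nseq n (true, 1)) xs = xs.
Proof. by move=> h; rewrite /ap_ob dec_nseq // -map_comp map_id. Qed.

Lemma ap_mor_nseq n (fs : seq (Mor A)) :
  size fs = n -> ap_mor (nseq n (true, 1)) fs = fs.
Proof. by move=> h; rewrite /ap_mor dec_nseq // -map_comp map_id. Qed.

Lemma ap_two_idl o n xs : size xs = n ->
  ap_two o o (nseq n (true, 1)) xs = map idm (ap_ob o xs).
Proof.
move=> h; rewrite /ap_two /blocks dec_nseq // dec_map -(unzip1_dec o xs) map_zip.
have -> : zip (dec o xs) (dec o xs) = [seq (y, y) | y <- dec o xs].
  by elim: (dec o xs) => //= y s ->.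
by rewrite -!map_comp; apply: eq_map => y /=; exact: two_cell_idl.
Qed.

Lemma ap_two_idr o n xs : size o = n ->
  ap_two o (nseq n (true, 1)) o xs = map idm (ap_ob o xs).
Proof.
move=> h; rewrite /ap_two /blocks dec_nseq ?size_dec //.
rewrite -(unzip1_dec o xs) map_zip.
have -> : zip (dec o xs) (dec o xs) = [seq (y, y) | y <- dec o xs].
  by elim: (dec o xs) => //= y s ->.
by rewrite -!map_comp; apply: eq_map => -[b ys] /=; exact: two_cell_idr.
Qed.

(** All four lists of 2-cells are indexed by the same list [Q] of threefold blocks, and
    [two_cell_coherence] applies entry by entry. *)
Lemma ap_two_coherence oij ojk okl oik ojl oil xs :
  ops_wf oij -> ops_wf ojk -> ops_wf okl -> ops_wf oik -> ops_wf ojl ->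
  ops_le oik ojk oij -> ops_le ojl okl ojk ->
  ops_le oil ojl oij -> ops_le oil okl oik ->
  sumn (unzip2 okl) = size ojk -> sumn (unzip2 ojk) = size oij ->
  sumn (unzip2 oij) = size xs ->
  map (@zcomp A) (zip (ap_two oil ojl oij xs)
                      (ap_two ojl okl ojk (ap_ob oij xs))) =
  map (@zcomp A) (zip (ap_two oil okl oik xs)
                      (ap_mor okl (ap_two oik ojk oij xs))).
Proof.
move=> wij wjk wkl wik wjl leijk lejkl leijl leikl skl sjk sij.
have sik : sumn (unzip2 oik) = size xs.
  have [/eqP-> _] := andP leijk.
  by rewrite -sumn_flatten reshapeKr ?size_map // -?sjk ?sij //.
have sjl : sumn (unzip2 ojl) = size oij.
  have [/eqP-> _] := andP lejkl.
  by rewrite -sumn_flatten reshapeKr ?size_map // -?skl ?sjk //.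
have skl' : sumn (unzip2 okl) = size oik by rewrite (size_ops_le leijk).
set V := blocks oik ojk oij xs; set D := dec okl V.
(* An entry of [Q] carries the flags from [oil] and [ojl], then the flag from [okl] with the part of
   [V] that this outermost operation consumes. *)
set a := unzip1 oil; set b := unzip1 ojl; pose Q := zip (zip a b) D.
have szl : size a = size b.
  by rewrite !size_map (size_ops_le leikl) (size_ops_le lejkl).
have decjk : dec ojk (dec oij xs) = map snd V by rewrite -(blocks2 xs leijk).
have bjl : blocks ojl okl ojk (ap_ob oij xs) =
    [seq (q.1.2, (q.2.1, [seq (y.2.1, op_obs y.2.2) | y <- q.2.2])) | q <- Q].
  rewrite /blocks /ap_ob dec_map decjk -map_comp dec_map zip_mapr -/b -/D.
  by rewrite (zip_zipr _ szl) -map_comp.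
have bijl : blocks oil ojl oij xs =
    [seq (q.1.1, (q.1.2, flatten [seq y.2.2 | y <- q.2.2])) | q <- Q].
  rewrite {1}/blocks (dec_blocks lejkl skl) ?size_dec // -/a.
  rewrite /blocks -/b decjk dec_map zip_mapr zip_zipA zip_mapr -/D -!map_comp.
  apply: eq_map => q /=.
  by rewrite /unzip2 -map_comp.
have bikl : blocks oil okl oik xs =
    [seq (q.1.1, (q.2.1, [seq (y.1, flatten (unzip2 y.2.2)) | y <- q.2.2]))
       | q <- Q].
  rewrite /blocks (dec_blocks leijk sjk sij) dec_map zip_mapr -/a -/D.
  by rewrite (zip_zipl _ szl) -map_comp.
have D2 : D = map snd Q.
  by rewrite -/(unzip2 Q) unzip2_zip // size_zip -szl minnn size_dec size_map
    (size_ops_le leikl).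
have mkl : ap_mor okl (ap_two oik ojk oij xs) =
    [seq op_mor q.2.1 [seq two_cell y.1 y.2.1 y.2.2 | y <- q.2.2] | q <- Q].
  by rewrite /ap_mor dec_map -/D D2 -!map_comp.
have wV := blocks_wf leijk wjk wij sjk sij.
have w1 := blocks_wf leijl wjl wij sjl sij.
have w2 := blocks_wf leikl wkl wik skl' sik.
have w3 : all (fun w => block_wf w.1 w.2.1 w.2.2)
    (blocks ojl okl ojk (ap_ob oij xs)).
  by apply: blocks_wf; rewrite // size_ap_ob.
have w4 : all (fun y => all (fun w => block_wf w.1 w.2.1 w.2.2) y.2) (map snd Q).
  by rewrite -D2; apply: all_dec.
rewrite mkl /ap_two bjl bijl bikl in w1 w2 w3 *.
rewrite !all_map in w1 w2 w3 w4.
rewrite -!map_comp !map_zip -!map_comp.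
have allI p q : all p Q -> all q Q -> all (predI p q) Q.
  by move=> hp hq; rewrite all_predI hp hq.
have wQ := allI _ _ (allI _ _ w1 w2) (allI _ _ w3 w4).
have -> : zip Q Q = [seq (q, q) | q <- Q] by elim: (Q) => //= y s ->.
rewrite -!map_comp; apply: eq_map_all wQ _ => q /=.
case/andP=> /andP[h1 h2] /andP[h3 h4].
exact: two_cell_coherence.
Qed.
End Coherence.

(** * Diagrams of powers of a category *)

(** The combinatorial skeleton of a simplex, independent of any lax monoidal category: [par] gives
    the exponents at the vertices and [pop] the operations along the edges. *)
Record pattern n := Pattern {
  par : 'I_n.+1 -> nat;
  pop : 'I_n.+1 -> 'I_n.+1 -> ops;
  size_pop : forall i j : 'I_n.+1, i <= j -> size (pop i j) = par j;
  sumn_pop : forall i j : 'I_n.+1, i <= j -> sumn (unzip2 (pop i j)) = par i;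
  wf_pop : forall i j : 'I_n.+1, i <= j -> ops_wf (pop i j);
  pop_id : forall i, pop i i = nseq (par i) (true, 1);
  pop_le : forall i j k : 'I_n.+1, i <= j -> j <= k ->
    ops_le (pop i k) (pop j k) (pop i j)
}.
Arguments Pattern {n par pop} _ _ _ _ _.

Section Diagram.
Variable M : lax_monoidal_category.
Local Notation A := (lm_cat M).

Definition ops_functor (o : ops) m n (e : size o = n) :
  word_functor (nseq m A) (nseq n A).
Proof.
apply: (@Functor (cprod (nseq m A)) (cprod (nseq n A))
  (fun x => seqh (etrans (size_ap_ob o (hseq x)) e))
  (fun f => seqh (etrans (size_ap_mor o (hseq f)) e))) => /=.
- by move=> f; apply: hseq_inj; rewrite !(seqhK, hseq_hmap) dom_ap_mor.
- by move=> f; apply: hseq_inj; rewrite !(seqhK, hseq_hmap) cod_ap_mor.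
- by move=> x; apply: hseq_inj; rewrite !(seqhK, hseq_hmap) ap_mor_idm.
- move=> g f h h'; apply: hseq_inj; rewrite !(seqhK, hseq_hcomp).
  by rewrite ap_mor_zcomp //; move/(congr1 (@hseq Ob A m)): h; rewrite !hseq_hmap.
Defined.

Lemma hseq_ops_functor_ob o m n (e : size o = n) (x : hprod Ob (nseq m A)) :
  hseq (Fo (ops_functor m e) x : hprod Ob (nseq n A)) = ap_ob o (hseq x).
Proof. exact: seqhK. Qed.

Lemma hseq_ops_functor_mor o m n (e : size o = n) (f : hprod Mor (nseq m A)) :
  hseq (Fm (ops_functor m e) f : hprod Mor (nseq n A)) = ap_mor o (hseq f).
Proof. exact: seqhK. Qed.

Section TwoCell.
Variables (o3 o2 o1 : ops) (m n k : nat).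
Hypotheses (e1 : size o1 = n) (e2 : size o2 = k) (e3 : size o3 = k).
Hypotheses (le : ops_le o3 o2 o1) (w2 : ops_wf o2) (w1 : ops_wf o1).
Hypotheses (s2 : sumn (unzip2 o2) = n) (s1 : sumn (unzip2 o1) = m).

Let s21 : sumn (unzip2 o2) = size o1.
Proof. by rewrite s2 e1. Qed.

Let size_arg P (x : hprod P (nseq m A)) : sumn (unzip2 o1) = size (hseq x).
Proof. by rewrite s1 size_hseq. Qed.

Definition ops_nattrans :
  nattrans (compF (ops_functor n e2) (ops_functor m e1)) (ops_functor m e3).
Proof.
apply: (@NatTrans (cprod (nseq m A)) (cprod (nseq k A))
   (compF (ops_functor n e2) (ops_functor m e1)) (ops_functor m e3)
   (fun x => seqh (etrans (size_ap_two le (hseq x)) e3) : hprod Mor (nseq k A)))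
  => /=.
- by move=> x; apply: hseq_inj; rewrite hseq_hmap !seqhK dom_ap_two.
- by move=> x; apply: hseq_inj; rewrite hseq_hmap !seqhK cod_ap_two.
- move=> f h h'; apply: hseq_inj; rewrite !hseq_hcomp !seqhK !hseq_hmap.
  exact: ap_two_natural.
Defined.

Lemma hseq_ops_nattrans (x : hprod Ob (nseq m A)) :
  hseq (ops_nattrans x : hprod Mor (nseq k A)) = ap_two o3 o2 o1 (hseq x).
Proof. exact: seqhK. Qed.
End TwoCell.

Definition diagram n (P : pattern n) : nsimp n.
Proof.
apply: (@NSimp n (fun i => nseq (par P i) A)
  (fun i j ij => ops_functor (par P i) (size_pop P ij))
  (fun i j k ij jk ik => ops_nattrans (size_pop P ij) (size_pop P jk)
     (size_pop P ik) (pop_le P ij jk) (wf_pop P jk) (wf_pop P ij)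
     (sumn_pop P jk) (sumn_pop P ij))).
- move=> i ii; apply: functor_eq => x; apply: hseq_inj.
    rewrite hseq_ops_functor_ob pop_id; exact: ap_ob_nseq (size_hseq x).
  rewrite hseq_ops_functor_mor pop_id; exact: ap_mor_nseq (size_hseq x).
- move=> i j ii ij ij' x; apply: hseq_inj; rewrite hseq_ops_nattrans.
  rewrite pop_id (ap_two_idl _ (size_hseq x)) hseq_hmap; congr map.
  by rewrite hseq_ops_functor_ob.
- move=> i j jj ij ij' x; apply: hseq_inj; rewrite hseq_ops_nattrans.
  rewrite pop_id (ap_two_idr _ (size_pop P ij)) hseq_hmap; congr map.
  by rewrite hseq_ops_functor_ob.
- move=> i j k l ij jk kl ik jl il x e e'; apply: hseq_inj.
  rewrite !hseq_hcomp !hseq_ops_nattrans hseq_ops_functor_ob hseq_ops_functor_mor.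
  rewrite hseq_ops_nattrans.
  apply: ap_two_coherence; rewrite ?(wf_pop, pop_le, sumn_pop, size_pop) //.
  by rewrite size_hseq.
Defined.
End Diagram.

(** * The operations attached to an inclusion of subsets *)

Definition ord_lt n : rel 'I_n := relpre val ltn.

Lemma ord_lt_trans n : transitive (@ord_lt n).
Proof. by move=> j i k; exact: ltn_trans. Qed.

Lemma ord_lt_irr n : irreflexive (@ord_lt n).
Proof. by move=> i; exact: ltnn. Qed.

Lemma sorted_enum_ord n : sorted (@ord_lt n) (enum 'I_n).
Proof. by rewrite -sorted_map val_enum_ord iota_ltn_sorted. Qed.

Lemma eq_ord_sorted n (s t : seq 'I_n) :
  sorted (@ord_lt n) s -> sorted (@ord_lt n) t -> s =i t -> s = t.
Proof. exact: irr_sorted_eq (@ord_lt_trans n) (@ord_lt_irr n) _ _. Qed.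

(** Supplies the start of the interval of [C] that ends in [c]. *)
Lemma set_predecessor n (C : {set 'I_n}) (p c : 'I_n) : p \in C -> p < c ->
  exists c0, [/\ c0 \in C, c0 < c &
    forall c' : 'I_n, c' \in C -> c' < c -> c' <= c0].
Proof.
move=> pC pc; case: (@arg_maxnP _ p (fun i => (i \in C) && (i < c)) val).
  by rewrite pC.
move=> c0 /andP[h1 h2] h3; exists c0; split=> // c' h4 h5.
by apply: h3; rewrite h4.
Qed.

(** Supplies the end of the interval of [C] that contains [d]. *)
Lemma set_successor n (C : {set 'I_n}) (q d : 'I_n) : q \in C -> d <= q ->
  exists c, [/\ c \in C, d <= c & forall c' : 'I_n, c' \in C -> c' < c -> c' < d].
Proof.
move=> qC dq; case: (@arg_minnP _ q (fun i => (i \in C) && (d <= i)) val).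
  by rewrite qC.
move=> c0 /andP[h1 h2] h3; exists c0; split=> // c' h4 h5.
rewrite ltnNge; apply/negP=> h6; have := h3 c'; rewrite h4 h6 => /(_ isT) /=; lia.
Qed.

Lemma sorted_ord_filter n (a : pred 'I_n) s :
  sorted (@ord_lt n) s -> sorted (@ord_lt n) (filter a s).
Proof. by apply: sorted_filter; exact: ord_lt_trans. Qed.

Section Operations.
Variables (n : nat) (X : rel 'I_n.+1).
Implicit Types (p q r c d e i j k : 'I_n.+1) (C D E : {set 'I_n.+1}).

(* The elements of [D] that end an interval of [D] labelled by [1]. *)
Definition active p D e :=
  [&& p < e, e \in D & [forall d in D, (d < e) ==> X d e]].

Definition act_seq p D := [seq e <- enum 'I_n.+1 | active p D e].

(* [e] lies in the interval of [C] ending in [c]. *)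
Definition in_block C c e :=
  (e <= c) && [forall c' in C, (c' < c) ==> (c' < e)].

(* The part of [D] in the interval [c0, c] of [C] is a degeneracy of the
   1-simplex [1]; such an interval contributes the identity functor. *)
Definition degenerate C D c :=
  [forall e in D, forall e' in D,
    [&& e <= e', e' <= c & [forall c' in C, (c' < c) ==> (c' <= e)]] ==>
    (X e e' == X e c && ~~ X e' c)].

(** The functor goes from the power indexed by the active elements of the larger set [D] to the one
    indexed by those of [C]. *)
Definition ops_of p C D : ops :=
  [seq (degenerate C D c, count (in_block C c) (act_seq p D)) | c <- act_seq p C].

Lemma activeP p D e :
  reflect [/\ p < e, e \in D & forall d, d \in D -> d < e -> X d e]
          (active p D e).
Proof.
apply: (iffP and3P) => -[h1 h2 h3]; split=> //.
  by move=> d dD de; move/forall_inP: h3 => /(_ d dD); rewrite de.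
by apply/forall_inP => d dD; apply/implyP; exact: h3.
Qed.

Lemma in_blockP C c e :
  reflect (e <= c /\ forall c', c' \in C -> c' < c -> c' < e) (in_block C c e).
Proof.
apply: (iffP andP) => -[h1 h2]; split=> //.
  by move=> d dD de; move/forall_inP: h2 => /(_ d dD); rewrite de.
by apply/forall_inP => d dD; apply/implyP; exact: h2.
Qed.

Lemma degenerateP C D c :
  reflect (forall e e', e \in D -> e' \in D -> e <= e' -> e' <= c ->
             (forall c', c' \in C -> c' < c -> c' <= e) ->
             X e e' = X e c && ~~ X e' c)
          (degenerate C D c).
Proof.
apply: (iffP forall_inP) => [h e e' eD e'D h1 h2 h3|h e eD].
  apply/eqP; move/forall_inP: (h e eD) => /(_ e' e'D) /implyP; apply.
  rewrite h1 h2; apply/forall_inP => c' c'C; apply/implyP; exact: h3.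
apply/forall_inP => e' e'D; apply/implyP=> /and3P[h1 h2 /forall_inP h3].
apply/eqP; apply: h => // c' /h3 /implyP; exact.
Qed.

Lemma mem_act_seq p D e : (e \in act_seq p D) = active p D e.
Proof. by rewrite mem_filter mem_enum andbT. Qed.

Lemma sorted_act_seq p D : sorted (@ord_lt _) (act_seq p D).
Proof. exact: sorted_ord_filter (sorted_enum_ord _). Qed.

(** These two hypotheses express a Catalan simplex: a triangle is admissible exactly when its long
    edge is 1 as soon as a short edge is. *)
Hypothesis X_lt : forall i j, X i j -> i < j.
Hypothesis X_le : forall i j k : 'I_n.+1,
  i <= j -> j <= k -> X i j || X j k -> X i k.

Lemma X_irr i : X i i = false.
Proof. by apply/negP=> /X_lt; rewrite ltnn. Qed.

Lemma X_leL i j k : i <= j -> X j k -> X i k.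
Proof.
by move=> ij jk; apply: X_le ij (ltnW (X_lt jk)) _; rewrite jk orbT.
Qed.

Lemma X_leR i j k : j <= k -> X i j -> X i k.
Proof.
by move=> jk ij; apply: X_le (ltnW (X_lt ij)) jk _; rewrite ij.
Qed.

Section Two.
Variables (p q : 'I_n.+1) (C D : {set 'I_n.+1}).
Hypotheses (bC : between p q C) (bD : between p q D) (CD : C \subset D).

(** Take the first [c] in [C] from [d] on. Elements of [C] below [c] lie below [d], are joined to
    [d] by 1, and hence to [c] by 1. *)
Lemma block_of_active d : active p D d ->
  exists2 c, active p C c & in_block C c d.
Proof.
case/betweenP: bC => pC qC hC; case/betweenP: bD => pD qD hD.
case/activeP=> pd dD hd; have /andP[_ dq] := hD _ dD.
have [c [cC dc hc]] := set_successor qC dq; exists c.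
  apply/activeP; split=> //; first exact: leq_trans dc.
  move=> c' c'C /(hc _ c'C) /hd h; apply: X_leR dc (h _).
  exact: (subsetP CD).
by apply/in_blockP.
Qed.

(** Both lists are strictly increasing with the same members, because each active element of [D]
    lies in an interval of [C] that is itself labelled 1. *)
Lemma flatten_blocks :
  flatten [seq [seq d <- act_seq p D | in_block C c d] | c <- act_seq p C] =
  act_seq p D.
Proof.
apply: eq_ord_sorted; last 2 first.
- exact: sorted_act_seq.
- move=> d; apply/flatten_mapP/idP => [[c _]|dD].
    by rewrite mem_filter => /andP[].
  have [|c cC cd] := @block_of_active d; first by rewrite -mem_act_seq.
  by exists c; rewrite ?mem_act_seq // mem_filter cd.
rewrite (sorted_pairwise (@ord_lt_trans _)).
have: all (fun c => c \in C) (act_seq p C).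
  by apply/allP=> c; rewrite mem_act_seq => /activeP[].
have := sorted_act_seq p C; rewrite (sorted_pairwise (@ord_lt_trans _)).
elim: (act_seq p C) => //= c s IH /andP[cs ss] /andP[cC sC].
rewrite pairwise_cat IH // andbT -(sorted_pairwise (@ord_lt_trans _)).
rewrite sorted_ord_filter ?sorted_act_seq // andbT.
apply/allrelP=> d d'; rewrite mem_filter => /andP[/in_blockP[dc _] _].
case/flatten_mapP=> c' c's; rewrite mem_filter => /andP[/in_blockP[_ h] _].
exact: leq_ltn_trans dc (h c cC (allP cs _ c's)).
Qed.

Lemma size_ops_of : size (ops_of p C D) = size (act_seq p C).
Proof. by rewrite size_map. Qed.

Lemma unzip2_ops_of : unzip2 (ops_of p C D) =
  shape [seq [seq d <- act_seq p D | in_block C c d] | c <- act_seq p C].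
Proof.
rewrite /unzip2 /shape -!map_comp; apply: eq_map => c /=.
by rewrite size_filter.
Qed.

Lemma sumn_ops_of : sumn (unzip2 (ops_of p C D)) = size (act_seq p D).
Proof. by rewrite unzip2_ops_of -size_flatten flatten_blocks. Qed.

(** A degeneracy of the 1-simplex 1 has a single spine edge labelled 1, the one leading from the
    vertices joined to [c] by 1 to those joined by 0. *)
Lemma degenerate_count c : active p C c -> degenerate C D c ->
  count (in_block C c) (act_seq p D) = 1.
Proof.
case/betweenP: bC => pC qC hC; case/betweenP: bD => pD qD hD.
case/activeP=> pc cC hc /degenerateP dg.
have [c0 [c0C c0c hc0]] := set_predecessor pC pc.
have sub := subsetP CD.
(* [e] is the first vertex of [D] after [c0] joined to [c] by 0; [c] itself is a candidate, its edge
   to itself being degenerate. *)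
have [e]: exists e, [/\ e \in D, ~~ X e c, e <= c, c0 < e &
    forall d, d \in D -> c0 <= d -> d < e -> X d c].
  case: (@arg_minnP _ c (fun i => [&& i \in D, ~~ X i c, i <= c & c0 < i]) val).
    by rewrite sub // X_irr leqnn c0c.
  move=> e /and4P[h1 h2 h3 h4] h5; exists e; split=> // d dD c0d de.
  move: c0d; rewrite leq_eqVlt => /orP[/eqP/val_inj <-|c0d]; first exact: hc.
  apply/negPn/negP=> h; have := h5 d.
  rewrite dD h c0d (leq_trans (ltnW de) h3) => /(_ isT) /=.
  by rewrite leqNgt de.
move=> [eD eNc ec c0e he].
have eact : active p D e.
  apply/activeP; split=> //.
    by have /andP[pc0 _] := hC _ c0C; exact: leq_ltn_trans c0e.
  move=> d dD de; case: (leqP c0 d) => [c0d|dc0].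
    rewrite dg //; [by rewrite he | exact: ltnW |].
    by move=> c' h1 h2; apply: leq_trans c0d; exact: hc0.
  apply: X_leL (ltnW dc0) _; rewrite dg //; [by rewrite hc | exact: sub |].
  exact: ltnW.
rewrite -size_filter.
suff -> : [seq d <- act_seq p D | in_block C c d] = [:: e] by [].
apply: eq_ord_sorted => //.
  exact: sorted_ord_filter (sorted_act_seq _ _).
move=> d; rewrite mem_filter mem_act_seq inE; apply/andP/eqP; last first.
  move=> ->; split=> //; apply/in_blockP; split=> // c' h1 h2.
  by apply: leq_ltn_trans c0e; exact: hc0.
case=> /in_blockP[dc hd] /activeP[pd dD hact].
(* Another active [d] is also joined to [c] by 0: it cannot precede [e] by minimality, nor follow
   it, as the edge from [e] to [d] would be 0. *)
have c0d : c0 < d by apply: hd.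
have dNc : X d c = false.
  have := dg c0 d (sub _ c0C) dD (ltnW c0d) dc hc0.
  by rewrite hact ?sub // hc //=; case: (X d c).
apply: val_inj => /=; case: (ltngtP d e) => // h.
  by rewrite he // ltnW in dNc.
have := hact _ eD h; rewrite (dg e d) ?(negPf eNc) //; first exact: ltnW.
by move=> c' h1 h2; apply: ltnW (leq_ltn_trans (hc0 _ h1 h2) _).
Qed.

Lemma ops_of_wf : ops_wf (ops_of p C D).
Proof.
rewrite /ops_wf all_map; apply/allP=> c; rewrite mem_act_seq => hc /=.
by apply/implyP=> /degenerate_count ->.
Qed.
End Two.

(** An interval of [D] has no vertex of [D] strictly inside, so the equality of [D] with itself
    gives only identity functors, as strict preservation of identities demands. *)
Lemma degenerate_id D d : degenerate D D d.
Proof.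
apply/degenerateP => e e' eD e'D ee' e'd h.
have [<-|ne] := eqVneq e e'; first by rewrite X_irr andbN.
have e'E : e' = d.
  apply: val_inj => /=; apply/eqP; rewrite eqn_leq e'd leqNgt /=.
  apply/negP=> /(h _ e'D) h'; case/negP: ne; apply/eqP/val_inj => /=; lia.
by rewrite e'E X_irr andbT.
Qed.

Lemma ops_of_id p q D : between p q D ->
  ops_of p D D = nseq (size (act_seq p D)) (true, 1).
Proof.
move=> bD; rewrite -(size_map
  (fun d => (degenerate D D d, count (in_block D d) (act_seq p D)))).
apply/all_pred1P; rewrite all_map; apply/allP=> d; rewrite mem_act_seq => hd /=.
by rewrite degenerate_id (degenerate_count bD bD (subxx D) hd) ?degenerate_id.
Qed.

Lemma dec_ops_of p q C D (T : Type) (g : 'I_n.+1 -> T) :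
  between p q C -> between p q D -> C \subset D ->
  dec (ops_of p C D) (map g (act_seq p D)) =
  [seq (degenerate C D c, [seq g d | d <- act_seq p D & in_block C c d])
     | c <- act_seq p C].
Proof.
move=> bC bD CD; rewrite dec_map /dec unzip2_ops_of.
rewrite -[X in reshape _ X](flatten_blocks bC bD CD) flattenK.
by rewrite /unzip1 -map_comp map_zip; elim: (act_seq p C) => //= c s ->.
Qed.

Section Three.
Variables (p q : 'I_n.+1) (C D E : {set 'I_n.+1}).
Hypotheses (bC : between p q C) (bD : between p q D) (bE : between p q E).
Hypotheses (CD : C \subset D) (DE : D \subset E).

(** Since [C] is contained in [D], no interval of [D] crosses an element of [C]. *)
Lemma in_block_trans c d e : c \in C -> d \in D -> in_block D d e ->
  in_block C c e = in_block C c d.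
Proof.
have sub := subsetP CD.
move=> cC dD /in_blockP[ed he]; apply/in_blockP/in_blockP=> -[h1 h2].
  split; last by move=> c' h3 h4; exact: leq_trans (h2 _ h3 h4) ed.
  by rewrite leqNgt; apply/negP=> /(he _ (sub _ cC)); lia.
split; first exact: leq_trans ed h1.
by move=> c' h3 h4; apply: he (sub _ h3) _; exact: h2.
Qed.

Lemma count_ops_of c : c \in C ->
  count (in_block C c) (act_seq p E) =
  sumn [seq count (in_block D d) (act_seq p E)
          | d <- act_seq p D & in_block C c d].
Proof.
move=> cC; rewrite -[X in count _ X = _](flatten_blocks bD bE DE) count_flatten.
rewrite -map_comp.
have : all (fun d => d \in D) (act_seq p D).
  by apply/allP=> d; rewrite mem_act_seq => /activeP[].
elim: (act_seq p D) => //= d s IH /andP[dD /IH ->]; rewrite count_filter.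
have [cd|ncd] := boolP (in_block C c d) => /=.
  congr (_ + _); apply: eq_count => e /=; apply: andb_idl => de.
  by rewrite (in_block_trans cC dD de).
rewrite (@eq_count _ _ pred0) ?count_pred0 // => e /=; apply/negP=> /andP[h1 h2].
by rewrite (in_block_trans cC dD h2) (negPf ncd) in h1.
Qed.

Lemma degenerate_outer c : degenerate C E c -> degenerate C D c.
Proof.
move=> /degenerateP h; apply/degenerateP=> e e' eD e'D.
by apply: h; exact: (subsetP DE).
Qed.

(** An active [d] lies after the jump, so it is joined to [c] by 0; therefore labels towards [d]
    agree with labels towards [c], and the condition at [c] restricts to [d]. *)
Lemma degenerate_inner c d : active p C c -> active p D d -> in_block C c d ->
  degenerate C E c -> degenerate D E d.
Proof.
case/activeP=> pc cC hc /activeP[pd dD hd] /in_blockP[dc hcd] /degenerateP dg.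
have [pD _ _] := betweenP _ _ _ bD.
have sub := subsetP CD; have sub' := subsetP DE.
have [d0 [d0D d0d hd0]] := set_predecessor pD pd.
(* The edge from the predecessor [d0] to [d] has label 1, which degeneracy allows only if [d] is
   joined to [c] by 0. *)
have dNc : X d c = false.
  have := dg d0 d (sub' _ d0D) (sub' _ dD) (ltnW d0d) dc.
  rewrite hd //; case: (X d c) => //; rewrite andbF; apply.
  by move=> c' h1 h2; apply: hd0 (sub _ h1) (hcd _ h1 h2).
apply/degenerateP=> e e' eE e'E ee' e'd he.
have he' c' : c' \in C -> c' < c -> c' <= e.
  by move=> h1 h2; apply: he (sub _ h1) (hcd _ h1 h2).
have dE := sub' _ dD.
rewrite (dg e e') //; last exact: leq_trans dc.
rewrite (dg e d) ?(dg e' d) ?dNc ?andbT //.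
  by move=> c' h1 h2; exact: leq_trans (he' _ h1 h2) ee'.
exact: leq_trans e'd.
Qed.

Lemma ops_of_le : ops_le (ops_of p C E) (ops_of p C D) (ops_of p D E).
Proof.
apply/andP; split.
  have -> : unzip2 (ops_of p D E) =
      [seq count (in_block D d) (act_seq p E) | d <- act_seq p D].
    by rewrite /unzip2 -map_comp.
  rewrite -unzip2_dec (dec_ops_of _ bC bD CD) /unzip2 -!map_comp; apply/eqP.
  by apply/eq_in_map => c; rewrite mem_act_seq => /activeP[_ /count_ops_of].
have -> : unzip1 (ops_of p D E) = [seq degenerate D E d | d <- act_seq p D].
  by rewrite /unzip1 -map_comp.
rewrite (dec_ops_of _ bC bD CD) /unzip1 -map_comp map_zip all_map.
have -> (s : seq 'I_n.+1) : zip s s = [seq (c, c) | c <- s].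
  by elim: s => //= c s ->.
rewrite all_map; apply/allP=> c; rewrite mem_act_seq => hc /=.
apply/implyP=> dg; rewrite (degenerate_outer dg) /= all_map.
apply/allP=> d; rewrite mem_filter mem_act_seq => /andP[h1 h2] /=.
exact: degenerate_inner hc h2 h1 dg.
Qed.
End Three.

Definition chain_pattern p q (k : nat) (c : chain p q k) : pattern k.
Proof.
apply: (@Pattern k (fun i : 'I_k.+1 => size (act_seq p (vert c i)))
  (fun i j : 'I_k.+1 => ops_of p (vert c j) (vert c i))).
- by move=> i j _; rewrite size_ops_of.
- move=> i j ij.
  exact: sumn_ops_of (vert_between c j) (vert_between c i) (vert_sub c ij).
- move=> i j ij.
  exact: ops_of_wf (vert_between c j) (vert_between c i) (vert_sub c ij).
- move=> i; exact: ops_of_id (vert_between c i).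
- move=> i j l ij jl; exact: ops_of_le (vert_between c l) (vert_between c j)
    (vert_between c i) (vert_sub c jl) (vert_sub c ij).
Defined.
End Operations.

(** * Invariance under monotone maps *)

Lemma mono_lt m n (g : mono m n) (i j : 'I_m.+1) : g i < g j -> i < j.
Proof. by rewrite !ltnNge; apply: contra => /(mfP g). Qed.

Section Image.
Variables (m n : nat) (g : mono m n) (X : rel 'I_n.+1).
Hypothesis X_lt : forall i j : 'I_n.+1, X i j -> i < j.
Local Notation Y := (relpre g X).
Variables (p q : 'I_m.+1).
Implicit Types (C D : {set 'I_m.+1}).

Lemma act_seq_image D : between p q D ->
  act_seq X (g p) (g @: D) = map g (act_seq Y p D).
Proof.
case/betweenP=> pD _ _; apply: eq_ord_sorted.
- exact: sorted_act_seq.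
- apply: (homo_sorted_in (P := active Y p D) (e := @ord_lt _)).
  + move=> e e' /activeP[_ eD _].
    by move=> /activeP[_ _ h] /(h _ eD) /X_lt.
  + by apply/allP=> e; rewrite mem_act_seq.
  + exact: sorted_act_seq.
move=> x; rewrite mem_act_seq; apply/activeP/mapP=> [[px xD hx]|[e]].
  case/imsetP: xD => e0 e0D xe0.
  (* Only the least element of [D] in a fibre of [g] can be active, because edges inside a fibre
     have label 0. *)
  case: (@arg_minnP _ e0 (fun i => (i \in D) && (g i == x)) val).
    by rewrite e0D xe0 eqxx.
  move=> e /andP[eD /eqP ge] he; exists e => //; rewrite mem_act_seq.
  apply/activeP; split=> //; first by apply: (@mono_lt _ _ g); rewrite ge.
  move=> d dD de; rewrite /= ge; apply: hx; first exact: imset_f.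
  have := mfP g (ltnW de); rewrite ge leq_eqVlt => /orP[/eqP/val_inj gd|//].
  by have := he d; rewrite dD gd eqxx /=; lia.
rewrite mem_act_seq => /activeP[pe eD he] ->; split.
- exact: X_lt (he _ pD pe).
- exact: imset_f.
- by move=> _ /imsetP[d dD ->] /mono_lt; exact: he.
Qed.

Section Block.
Variables (C D : {set 'I_m.+1}) (c : 'I_m.+1).
Hypotheses (bC : between p q C) (CD : C \subset D).
Hypothesis (hc : active Y p C c).

Let Clt c' : c' \in C -> c' < c -> g c' < g c.
Proof. by case/activeP: hc => _ _ h /h{}h /h /X_lt. Qed.

Lemma in_block_image d : active Y p D d ->
  in_block (g @: C) (g c) (g d) = in_block C c d.
Proof.
have [pc cC _] := activeP _ _ _ _ hc; have sub := subsetP CD.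
case/activeP=> pd dD hd; apply/in_blockP/in_blockP=> -[h1 h2]; split.
- rewrite leqNgt; apply/negP=> cd; have := hd _ (sub _ cC) cd.
  by move/X_lt; lia.
- move=> c' h3 h4; apply: (@mono_lt _ _ g).
  exact: h2 (imset_f _ h3) (Clt h3 h4).
- exact: mfP.
- move=> _ /imsetP[c' c'C ->] /mono_lt h; apply: X_lt.
  exact: hd (sub _ c'C) (h2 _ c'C h).
Qed.

Lemma degenerate_image :
  degenerate X (g @: C) (g @: D) (g c) = degenerate Y C D c.
Proof.
have [pc cC _] := activeP _ _ _ _ hc; have sub := subsetP CD.
have pC : p \in C by case/betweenP: bC.
have Xirr i : X i i = false by apply/negP=> /X_lt; rewrite ltnn.
apply/degenerateP/degenerateP=> h.
  move=> e e' eD e'D ee' e'c he; apply: h => //; try exact: imset_f.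
  - exact: mfP.
  - exact: mfP.
  - by move=> _ /imsetP[c' c'C ->] /mono_lt h; apply: mfP; exact: he.
move=> _ _ /imsetP[e eD ->] /imsetP[e' e'D ->] gee' ge'c he.
have [geq|gne] := eqVneq (g e) (g e'); first by rewrite geq Xirr andbN.
have [gcq|gcne] := eqVneq (g e') (g c); first by rewrite gcq Xirr andbT.
have gee'' : g e < g e' by rewrite ltn_neqAle gee' andbT.
have ge'c' : g e' < g c by rewrite ltn_neqAle ge'c andbT.
have [c0 [c0C c0c hc0]] := set_predecessor pC pc.
have gc0 : g c0 <= g e by apply: he (imset_f _ c0C) (Clt c0C c0c).
(* The chosen [e] may precede the start [c0] of the interval while having the same image; [c0] then
   replaces it. *)
have [c0e|ec0] := leqP c0 e.
  apply: h => //; [exact: ltnW (mono_lt gee'')|exact: ltnW (mono_lt ge'c')|].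
  by move=> c' h1 h2; exact: leq_trans (hc0 _ h1 h2) c0e.
have -> : g e = g c0.
  by apply/val_inj/eqP; rewrite eqn_leq gc0 (mfP g (ltnW ec0)).
apply: (h c0 e') => //; first exact: sub.
  by apply: ltnW (@mono_lt _ _ g _ _ _); exact: leq_ltn_trans gc0 gee''.
exact: ltnW (mono_lt ge'c').
Qed.
End Block.

(** Repeating a vertex only adds edges labelled 0 and creates no new condition for degeneracy. This
    is what makes the construction compatible with degeneracies. *)
Lemma ops_of_image C D : between p q C -> between p q D -> C \subset D ->
  ops_of X (g p) (g @: C) (g @: D) = ops_of Y p C D.
Proof.
move=> bC bD CD; rewrite /ops_of !act_seq_image // -map_comp.
apply/eq_in_map=> c; rewrite mem_act_seq => hc /=.
rewrite (degenerate_image bC CD hc) count_map; congr pair.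
apply: eq_in_count => d; rewrite mem_act_seq; exact: in_block_image.
Qed.
End Image.

(** * Unions of adjacent subsets *)

Section Union.
Variables (n : nat) (X : rel 'I_n.+1).
Hypothesis X_lt : forall i j : 'I_n.+1, X i j -> i < j.
Hypothesis X_le : forall i j k : 'I_n.+1,
  i <= j -> j <= k -> X i j || X j k -> X i k.
Variables (p q r : 'I_n.+1).
Implicit Types (C D : {set 'I_n.+1}) (c d e : 'I_n.+1).

Lemma mem_union_left D D' e : between p q D -> between q r D' -> e <= q ->
  (e \in D :|: D') = (e \in D).
Proof.
case/betweenP=> _ qD _ /betweenP[_ _ h'] eq; rewrite inE.
apply: orb_idr => /h' /andP[qe _].
by have -> : e = q by apply: val_inj => /=; apply/eqP; rewrite eqn_leq eq.
Qed.

Lemma mem_union_right D D' e : between p q D -> between q r D' -> q <= e ->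
  (e \in D :|: D') = (e \in D').
Proof.
case/betweenP=> _ _ h /betweenP[qD _ _] qe; rewrite inE.
apply: orb_idl => /h /andP[_ eq].
by have -> : e = q by apply: val_inj => /=; apply/eqP; rewrite eqn_leq eq.
Qed.

Lemma active_union D D' e : between p q D -> between q r D' ->
  active X p (D :|: D') e = if e <= q then active X p D e else active X q D' e.
Proof.
move=> bD bD'; have [pD qD hD] := betweenP _ _ _ bD.
have [qD' rD' hD'] := betweenP _ _ _ bD'.
have pq : p <= q by case/andP: (hD _ qD).
case: leqP => eq.
  rewrite /active (mem_union_left bD bD' eq); congr [&& _, _ & _].
  apply/forall_inP/forall_inP=> h d dD; apply/implyP=> de; move: (h d).
    by rewrite inE dD de => /(_ isT).
  by rewrite (mem_union_left bD bD') in dD; [rewrite dD de => /(_ isT) | lia].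
apply/activeP/activeP=> -[h1 h2 h3]; split=> //.
- by rewrite (mem_union_right bD bD') // ltnW in h2.
- by move=> d dD' de; apply: h3; rewrite // inE dD' orbT.
- exact: leq_ltn_trans eq.
- by rewrite inE h2 orbT.
(* For [d] up to [q], the label 1 of the edge from [q] to [e] passes to the longer edge from [d]. *)
- move=> d dD de; have [dq|qd] := leqP d q.
    apply: X_le dq (ltnW eq) _; rewrite (h3 q) ?orbT //.
  apply: h3 => //; by rewrite (mem_union_right bD bD') // ltnW in dD.
Qed.

Lemma act_seq_union D D' : between p q D -> between q r D' ->
  act_seq X p (D :|: D') = act_seq X p D ++ act_seq X q D'.
Proof.
move=> bD bD'; have [pD qD hD] := betweenP _ _ _ bD.
apply: eq_ord_sorted; first exact: sorted_act_seq.
  rewrite (sorted_pairwise (@ord_lt_trans _)) pairwise_cat.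
  rewrite -!(sorted_pairwise (@ord_lt_trans _)) !sorted_act_seq !andbT.
  apply/allrelP=> d d'; rewrite !mem_act_seq => /activeP[_ dD _] /activeP[qd' _ _].
  by have := hD _ dD; rewrite /ord_lt /=; lia.
move=> e; rewrite mem_cat !mem_act_seq active_union //; case: leqP => eq.
  rewrite orb_idr // => /activeP[]; lia.
rewrite orb_idl // => /activeP[_ /hD]; lia.
Qed.

(** As [q] belongs to all four sets, every interval lies on one side of it, so composition by union
    becomes concatenation of operations. *)
Lemma ops_of_union C C' D D' : between p q C -> between q r C' ->
  between p q D -> between q r D' -> C \subset D -> C' \subset D' ->
  ops_of X p (C :|: C') (D :|: D') = ops_of X p C D ++ ops_of X q C' D'.
Proof.
move=> bC bC' bD bD' CD CD'; rewrite /ops_of !act_seq_union // map_cat.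
have [pC qC hC] := betweenP _ _ _ bC; have [qC' rC' hC'] := betweenP _ _ _ bC'.
have [pD qD hD] := betweenP _ _ _ bD; have [qD' rD' hD'] := betweenP _ _ _ bD'.
congr cat; apply/eq_in_map=> c; rewrite mem_act_seq => /activeP[lc cC _].
  have cq : c <= q by case/andP: (hC _ cC).
  have lt_mem c' : c' < c -> (c' \in C :|: C') = (c' \in C).
    by move=> h; rewrite (mem_union_left bC bC') // ltnW // (leq_trans h).
  congr pair.
    apply/degenerateP/degenerateP=> h e e' eD e'D ee' e'c he.
      apply: h => //; rewrite ?inE ?eD ?e'D // => c' + c'c.
      by rewrite lt_mem // => /he; exact.
    have e'q := leq_trans e'c cq; have eq := leq_trans ee' e'q.
    rewrite (mem_union_left bD bD' eq) in eD.
    rewrite (mem_union_left bD bD' e'q) in e'D.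
    apply: h => // c' c'C c'c; apply: he => //; by rewrite lt_mem.
  rewrite count_cat [X in _ + X](@eq_in_count _ _ pred0) ?count_pred0 ?addn0.
    apply: eq_count => d; apply/in_blockP/in_blockP=> -[h1 h2]; split=> // c' h3 h4.
      by apply: h2; rewrite ?lt_mem.
    by apply: h2; rewrite -?lt_mem.
  move=> d; rewrite mem_act_seq => /activeP[qd _ _]; apply/negP=> /in_blockP[dc _].
  by have := leq_trans qd (leq_trans dc cq); rewrite ltnn.
have lt_mem c' : q <= c' -> (c' \in C :|: C') = (c' \in C').
  by move=> h; rewrite (mem_union_right bC bC').
congr pair.
  apply/degenerateP/degenerateP=> h e e' eD e'D ee' e'c he.
    apply: h => //; rewrite ?inE ?eD ?e'D ?orbT // => c' + c'c.
    have [/hD' /andP[qe _] _] := (eD, e'D).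
    have [qc'|c'q] := leqP q c'; first by rewrite lt_mem // => /he; exact.
    by move=> _; exact: leq_trans (ltnW c'q) qe.
  have qe : q <= e by apply: he => //; rewrite inE qC.
  have qe' := leq_trans qe ee'.
  rewrite (mem_union_right bD bD' qe) in eD.
  rewrite (mem_union_right bD bD' qe') in e'D.
  apply: h => // c' c'C c'c; apply: he => //; by rewrite inE c'C orbT.
rewrite count_cat [X in X + _](@eq_in_count _ _ pred0) ?count_pred0 ?add0n.
  apply: eq_in_count => d; rewrite mem_act_seq => /activeP[qd _ _].
  apply/in_blockP/in_blockP=> -[h1 h2]; split=> // c' h3 h4.
    by apply: h2; rewrite // inE h3 orbT.
  have [qc'|c'q] := leqP q c'; last exact: leq_ltn_trans (ltnW c'q) qd.
  by apply: h2; rewrite -?lt_mem.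
move=> d; rewrite mem_act_seq => /activeP[_ /hD /andP[_ dq] _].
by apply/negP=> /in_blockP[_ /(_ q)]; rewrite inE qC lc ltnNge dq => /(_ isT isT).
Qed.

Lemma act_seq_point : act_seq X p [set p] = [::].
Proof.
apply: eq_ord_sorted => //; first exact: sorted_act_seq.
move=> e; rewrite mem_act_seq; apply/negP=> /activeP[pe]; rewrite inE => /eqP ep.
by rewrite ep ltnn in pe.
Qed.
End Union.

(** * Equality, products, units and restriction of diagrams *)

Lemma dec_cat T (o1 o2 : ops) (xs ys : seq T) : sumn (unzip2 o1) = size xs ->
  dec (o1 ++ o2) (xs ++ ys) = dec o1 xs ++ dec o2 ys.
Proof.
elim: o1 xs => [[]|[b k] o1 IH xs] //= h.
have hk : k <= size xs by rewrite -h leq_addr.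
have [h1 h2] : take k (xs ++ ys) = take k xs /\ drop k (xs ++ ys) = drop k xs ++ ys.
  rewrite take_cat drop_cat; case: ltnP hk => // h1 h2.
  have -> : k = size xs by apply/eqP; rewrite eqn_leq h2.
  by rewrite subnn take0 drop0 cats0 take_size drop_size.
rewrite /dec /= h1 h2; congr cons; apply: IH.
by rewrite size_drop -h addKn.
Qed.

Lemma blocks_cat T (o3 o2 o1 o3' o2' o1' : ops) (xs ys : seq T) :
  size o3 = size o2 -> sumn (unzip2 o2) = size o1 -> sumn (unzip2 o1) = size xs ->
  blocks (o3 ++ o3') (o2 ++ o2') (o1 ++ o1') (xs ++ ys) =
  blocks o3 o2 o1 xs ++ blocks o3' o2' o1' ys.
Proof.
move=> h3 h2 h1; rewrite /blocks (dec_cat _ _ h1) dec_cat ?size_dec //.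
by rewrite /unzip1 map_cat zip_cat // size_dec size_map.
Qed.

Section DiagramEq.
Variable M : lax_monoidal_category.
Local Notation A := (lm_cat M).

Lemma ap_ob_cat (o1 o2 : ops) (xs ys : seq (Ob A)) :
  sumn (unzip2 o1) = size xs ->
  ap_ob (o1 ++ o2) (xs ++ ys) = ap_ob o1 xs ++ ap_ob o2 ys.
Proof. by move=> h; rewrite /ap_ob dec_cat // map_cat. Qed.

Lemma ap_mor_cat (o1 o2 : ops) (xs ys : seq (Mor A)) :
  sumn (unzip2 o1) = size xs ->
  ap_mor (o1 ++ o2) (xs ++ ys) = ap_mor o1 xs ++ ap_mor o2 ys.
Proof. by move=> h; rewrite /ap_mor dec_cat // map_cat. Qed.

Lemma ap_two_cat (o3 o2 o1 o3' o2' o1' : ops) (xs ys : seq (Ob A)) :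
  size o3 = size o2 -> sumn (unzip2 o2) = size o1 -> sumn (unzip2 o1) = size xs ->
  ap_two (o3 ++ o3') (o2 ++ o2') (o1 ++ o1') (xs ++ ys) =
  ap_two o3 o2 o1 xs ++ ap_two o3' o2' o1' ys.
Proof. by move=> h3 h2 h1; rewrite /ap_two blocks_cat // map_cat. Qed.

Lemma hlist_inj_hseq (P : category -> Type) m n
    (x : hprod P (nseq m A)) (y : hprod P (nseq n A)) :
  hlist x = hlist y -> hseq x = hseq y.
Proof. by rewrite !hlist_hseq => /map_existT_inj. Qed.

Lemma hseq_cat_hlist (P : category -> Type) m n l
    (x : hprod P (nseq m A)) (y : hprod P (nseq n A ++ nseq l A)) :
  hlist x = hlist y -> hseq x = hseq (htake y) ++ hseq (hdrop y).
Proof.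
move=> h; apply: (@map_existT_inj P A).
by rewrite map_cat -!hlist_hseq h hlist_take_drop.
Qed.

Variable n : nat.
Implicit Types (P Q R : pattern n).

Lemma hlist_nfun_ob P (i j : 'I_n.+1) (ij : i <= j) x :
  hlist (Fo (nfun (diagram M P) ij) x : hprod Ob _) =
  map (existT Ob A) (ap_ob (pop P i j) (hseq x)).
Proof. by rewrite hlist_hseq hseq_ops_functor_ob. Qed.

Lemma hlist_nfun_mor P (i j : 'I_n.+1) (ij : i <= j) x :
  hlist (Fm (nfun (diagram M P) ij) x : hprod Mor _) =
  map (existT Mor A) (ap_mor (pop P i j) (hseq x)).
Proof. by rewrite hlist_hseq hseq_ops_functor_mor. Qed.

Lemma hlist_nnat P (i j k : 'I_n.+1) (ij : i <= j) (jk : j <= k) (ik : i <= k) x :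
  hlist (nnat (diagram M P) ij jk ik x : hprod Mor _) =
  map (existT Mor A) (ap_two (pop P i k) (pop P j k) (pop P i j) (hseq x)).
Proof. by rewrite hlist_hseq hseq_ops_nattrans. Qed.

Lemma diagram_eq P Q : (forall i, par P i = par Q i) ->
  (forall i j : 'I_n.+1, i <= j -> pop P i j = pop Q i j) ->
  diagram M P = diagram M Q.
Proof.
move=> ha ho; apply: nsimp_eq => [i|i j ij x y|i j ij x y|i j k ij jk ik x y].
- by rewrite /= ha.
- by move/hlist_inj_hseq=> h; rewrite !hlist_nfun_ob ho // h.
- by move/hlist_inj_hseq=> h; rewrite !hlist_nfun_mor ho // h.
- by move/hlist_inj_hseq=> h; rewrite !hlist_nnat !ho // h.
Qed.

Lemma diagram_tens P Q R : (forall i, par R i = par P i + par Q i) ->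
  (forall i j : 'I_n.+1, i <= j -> pop R i j = pop P i j ++ pop Q i j) ->
  diagram M R = nsimp_tens (diagram M P) (diagram M Q).
Proof.
move=> ha ho; apply: nsimp_eq => [i|i j ij x y|i j ij x y|i j k ij jk ik x y].
- by rewrite /= ha nseqD.
- move/hseq_cat_hlist=> h; rewrite /= hlist_app !hlist_nfun_ob -map_cat ho // h.
  by rewrite ap_ob_cat // size_hseq sumn_pop.
- move/hseq_cat_hlist=> h; rewrite /= hlist_app !hlist_nfun_mor -map_cat ho // h.
  by rewrite ap_mor_cat // size_hseq sumn_pop.
- move/hseq_cat_hlist=> h; rewrite /= hlist_app !hlist_nnat -map_cat !ho // h.
  by rewrite ap_two_cat // ?size_hseq ?sumn_pop ?size_pop.
Qed.

Lemma diagram_unit P : (forall i, par P i = 0) -> diagram M P = nsimp_unit n.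
Proof.
move=> ha.
have ho (i j : 'I_n.+1) : i <= j -> pop P i j = [::].
  by move=> ij; apply: size0nil; rewrite size_pop.
apply: nsimp_eq => [i|i j ij x y _|i j ij x y _|i j k ij jk ik x y _].
- by rewrite /= ha.
- by rewrite hlist_nfun_ob ho.
- by rewrite hlist_nfun_mor ho.
- by rewrite hlist_nnat !ho.
Qed.
End DiagramEq.

Lemma diagram_act (M : lax_monoidal_category) m n (f : mono m n)
    (P : pattern n) (Q : pattern m) :
  (forall i, par Q i = par P (f i)) ->
  (forall i j : 'I_m.+1, i <= j -> pop Q i j = pop P (f i) (f j)) ->
  diagram M Q = nsimp_act f (diagram M P).
Proof.
move=> ha ho; apply: nsimp_eq => [i|i j ij x y|i j ij x y|i j k ij jk ik x y].
- by rewrite /= ha.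
- by move/hlist_inj_hseq=> h; rewrite !hlist_nfun_ob ho // h.
- by move/hlist_inj_hseq=> h; rewrite !hlist_nfun_mor ho // h.
- by move/hlist_inj_hseq=> h; rewrite !hlist_nnat !ho // h.
Qed.

(** * The simplicial map of a lax monoidal category *)

Section EdgeRel.
Variables (n : nat) (x : catalan_simp n).

(** A form of the labels free of proofs of [i <= j], with value [false] when the inequality
    fails. *)
Definition edge_rel : rel 'I_n.+1 := fun i j =>
  if @idP (i <= j) is ReflectT ij then edge x ij else false.

Lemma edge_relE (i j : 'I_n.+1) (ij : i <= j) : edge_rel i j = edge x ij.
Proof.
rewrite /edge_rel; case: {-}_ / idP => [h|/(_ ij)] //.
by rewrite (bool_irrelevance h ij).
Qed.

Lemma edge_rel_lt (i j : 'I_n.+1) : edge_rel i j -> i < j.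
Proof.
have [ij|ij] := leqP i j; last by rewrite /edge_rel; case: {-}_ / idP => //; lia.
rewrite leq_eqVlt in ij; case/orP: ij => [/eqP/val_inj <-|//].
by rewrite (edge_relE (leqnn i)) edge_refl.
Qed.

Lemma edge_rel_le (i j k : 'I_n.+1) : i <= j -> j <= k ->
  edge_rel i j || edge_rel j k -> edge_rel i k.
Proof.
move=> ij jk; have ik := leq_trans ij jk; rewrite !edge_relE.
have := edge_triangle x ij jk ik.
by case: (edge x ij); case: (edge x jk); case: (edge x ik).
Qed.
End EdgeRel.

Lemma edge_rel_act m n (f : mono m n) (x : catalan_simp n) :
  edge_rel (catalan_act f x) = relpre f (edge_rel x).
Proof.
apply: functional_extensionality => i; apply: functional_extensionality => j.
have [ij|ji] := leqP i j; first by rewrite /= (edge_relE x (mfP f ij)) edge_relE.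
apply/idP/idP => /edge_rel_lt; first by lia.
by move/mono_lt; lia.
Qed.

Definition simp_pattern n (x : catalan_simp n) (p q : 'I_n.+1) k
  (c : chain p q k) : pattern k :=
  chain_pattern (@edge_rel_lt n x) (@edge_rel_le n x) c.

Section Alpha.
Variable M : lax_monoidal_category.

Definition alpha_simp n (x : catalan_simp n) : sfunctor (cohS n) N2Cat.
Proof.
unshelve eapply (@SFunctor (cohS n) N2Cat (fun _ => tt)).
- move=> p q; apply: (@SMap (chains p q) nsimps
    (fun k c => diagram M (simp_pattern x c))).
  move=> k l f c; exact: diagram_act.
- move=> p q r k c d; apply: diagram_tens => /= [i|i j ij].
    by rewrite (act_seq_union (@edge_rel_le n x) (vert_between c i)
      (vert_between d i)) size_cat.
  exact: (ops_of_union (@edge_rel_le n x) (vert_between c j)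
    (vert_between d j) (vert_between c i) (vert_between d i) (vert_sub c ij)
    (vert_sub d ij)).
- by move=> p k; apply: diagram_unit => i /=; rewrite act_seq_point.
Defined.

Definition alpha : smap Catalan (hc_nerve N2Cat).
Proof.
apply: (@SMap Catalan (hc_nerve N2Cat) alpha_simp).
move=> m n f x; apply: sfunctor_eq => p q k c; apply: diagram_eq => [i|i j ij] /=.
  by rewrite edge_rel_act
    (act_seq_image f (@edge_rel_lt n x) (vert_between c i)) size_map.
rewrite edge_rel_act.
by rewrite (ops_of_image f (@edge_rel_lt n x) (vert_between c j)
  (vert_between c i) (vert_sub c ij)).
Defined.
End Alpha.

(** * Recovering the lax monoidal category *)

(** Consecutive vertices are joined by the labels [a], all longer edges carry 1. *)
Definition spine_edge (a : nat -> bool) (i j : nat) :=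
  (i < j) && ((i.+1 < j) || a i).

(* A triangle with long edge [1] is always allowed, so the labels [a] of the
   consecutive edges are arbitrary. *)
Definition spine_simp n (a : nat -> bool) : catalan_simp n.
Proof.
apply: (@CatalanSimp n (fun i j _ => spine_edge a i j)).
- by move=> i _; rewrite /spine_edge ltnn.
- move=> i j k ij jk ik.
  suff : spine_edge a i j || spine_edge a j k -> spine_edge a i k.
    by case: (spine_edge a i j) (spine_edge a j k) (spine_edge a i k)
      => [] [] [] // /(_ isT).
  rewrite /spine_edge; case/orP=> /andP[h1 h2].
    case: (ltngtP j k) jk => // [jk _|/val_inj <- _]; last by rewrite h1 h2.
    by rewrite (ltn_trans h1 jk) (leq_trans _ jk).
  case: (ltngtP i j) ij => // [ij _|/val_inj -> _]; last by rewrite h1 h2.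
  by rewrite (ltn_trans ij h1) (leq_ltn_trans ij h1).
Defined.

(** * Intervals and pairs of vertices *)

Definition interval n (p q : 'I_n.+1) : {set 'I_n.+1} :=
  [set e : 'I_n.+1 | p <= e <= q].

Lemma between_interval n (p q : 'I_n.+1) : p <= q -> between p q (interval p q).
Proof.
by move=> pq; apply/betweenP; split=> [||i]; rewrite inE ?leqnn ?pq.
Qed.

Lemma between_pair n (p q : 'I_n.+1) : p <= q -> between p q [set p; q].
Proof.
move=> pq; apply/betweenP; split=> [||i]; rewrite !inE ?eqxx ?orbT //.
by case/orP=> /eqP ->; rewrite leqnn pq.
Qed.

Lemma between_sub n (p q : 'I_n.+1) D : between p q D -> D \subset interval p q.
Proof. by case/betweenP=> _ _ h; apply/subsetP=> i /h; rewrite inE. Qed.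

Lemma pair_sub n (p q : 'I_n.+1) D : between p q D -> [set p; q] \subset D.
Proof. by case/betweenP=> h1 h2 _; rewrite subUset !sub1set h1 h2. Qed.

Lemma interval_point n (p : 'I_n.+1) : interval p p = [set p].
Proof. by apply/setP=> i; rewrite !inE -eqn_leq eq_sym. Qed.

Lemma interval_union n (p q r : 'I_n.+1) : p <= q -> q <= r ->
  interval p r = interval p q :|: interval q r.
Proof.
move=> pq qr; apply/setP=> i; rewrite !inE.
case: (leqP i q) => iq /=; last first.
  by rewrite andbF (ltnW (leq_ltn_trans pq iq)) (ltnW iq).
rewrite andbT (leq_trans iq qr) andbT; case: (leqP p i) => //= ip.
by rewrite leqNgt (leq_trans ip).
Qed.

(** * Operations in a simplex with prescribed spine *)

Section Spine.
Variables (n : nat) (a : nat -> bool).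
Local Notation x := (spine_simp n a).
Local Notation X := (edge_rel x).
Implicit Types (p q r e : 'I_n.+1) (C D : {set 'I_n.+1}).

Lemma edge_rel_spine (i j : 'I_n.+1) : X i j = spine_edge a i j.
Proof.
have [ij|ji] := leqP i j; first by rewrite (edge_relE _ ij).
rewrite /spine_edge ltnNge ltnW //=; apply/negP=> /edge_rel_lt.
by rewrite ltnNge ltnW.
Qed.

Lemma size_act_seq_interval p q :
  p <= q -> size (act_seq X p (interval p q)) = count a (iota p (q - p)).
Proof.
move: {2}(q - p) (erefl (q - p)) => l; elim: l q => [|l IH] q hl pq.
  have -> : q = p by apply: val_inj; apply/eqP; rewrite eqn_leq pq -subn_eq0 hl.
  by rewrite interval_point act_seq_point subnn.
have hr : q.-1 < n.+1 by apply: leq_ltn_trans (leq_pred q) _.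
(* Splitting off the last edge, from [r] to [q], adds one active vertex exactly when [a r] holds. *)
pose r : 'I_n.+1 := Ordinal hr.
have rE : q = r.+1 :> nat by rewrite /= prednK //; move: hl; case: (val q).
have pr : p <= r by rewrite /=; move: rE hl => /=; lia.
have rq : r <= q by rewrite rE.
have hl' : r - p = l by rewrite rE subSn // in hl; case: hl.
rewrite (interval_union pr rq) (act_seq_union (@edge_rel_le _ x)
  (between_interval pr) (between_interval rq)) size_cat IH // hl' hl.
rewrite -[l.+1]addn1 iotaD count_cat /= addn0; congr (_ + _).
have -> : p + l = r by rewrite -hl' subnKC.
have edge : X r q = a r by rewrite edge_rel_spine /spine_edge rE leqnn ltnn.
case ar: (a r).
  suff -> : act_seq X r (interval r q) = [:: q] by [].
  apply: eq_ord_sorted => // [|e]; first exact: sorted_act_seq.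
  rewrite mem_act_seq inE; apply/activeP/eqP=> [[re]|->].
    rewrite inE rE => /andP[_ er] _; apply: val_inj => /=; rewrite rE.
    by apply/eqP; rewrite eqn_leq er re.
  split; rewrite ?inE ?rE ?leqnSn ?leqnn //.
  move=> d; rewrite inE ltnS => /andP[rd _] dr.
  have -> : d = r by apply: val_inj; apply/eqP; rewrite eqn_leq rd dr.
  by rewrite edge ar.
suff -> : act_seq X r (interval r q) = [::] by [].
apply: eq_ord_sorted => // [|e]; first exact: sorted_act_seq.
rewrite mem_act_seq; apply/negP=> /activeP[re]; rewrite inE rE => /andP[_ er].
have -> : e = q.
  by apply: val_inj => /=; rewrite rE; apply/eqP; rewrite eqn_leq er re.
by move/(_ r); rewrite inE rE leqnSn !leqnn => /(_ isT isT); rewrite edge ar.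
Qed.

Lemma act_seq_pair p q : X p q -> act_seq X p [set p; q] = [:: q].
Proof.
move=> hX; have pq := edge_rel_lt hX.
apply: eq_ord_sorted => // [|e]; first exact: sorted_act_seq.
rewrite mem_act_seq inE; apply/activeP/eqP=> [[pe]|->].
  by rewrite !inE => /orP[/eqP ep|/eqP //] _; rewrite ep ltnn in pe.
split; rewrite ?inE ?eqxx ?orbT // => d; rewrite !inE => /orP[]/eqP-> //.
by rewrite ltnn.
Qed.

Lemma ops_of_pair p q D : X p q -> between p q D ->
  ops_of X p [set p; q] D =
  [:: (degenerate X [set p; q] D q, size (act_seq X p D))].
Proof.
move=> hX bD; have bC := between_pair (ltnW (edge_rel_lt hX)).
rewrite -(sumn_ops_of (@edge_rel_lt _ x) (@edge_rel_le _ x) bC bD (pair_sub bD)).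
by rewrite /ops_of act_seq_pair //= addn0.
Qed.

Lemma ops_of_interval_nil p q : p <= q -> count a (iota p (q - p)) = 0 ->
  ops_of X p (interval p q) (interval p q) = [::].
Proof.
move=> pq h; rewrite (ops_of_id (@edge_rel_lt _ x) (@edge_rel_le _ x)
  (between_interval pq)).
by rewrite size_act_seq_interval // h.
Qed.

(** The vertices [e], [e'], [q] span the triangle [u]. Degeneracy would give the edge from [e] to
    [e'] label 1, since [e] is joined to [q] by 1 and [e'] by 0. *)
Lemma nondegenerate_pair p q D (e e' : 'I_n.+1) : e \in D -> e' \in D ->
  p <= e -> e.+1 = e' -> e'.+1 = q -> a e = false -> a e' = false ->
  degenerate X [set p; q] D q = false.
Proof.
move=> eD e'D pe ee' e'q ae ae'; apply/negP=> /degenerateP dg.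
have h1 : e <= e' by rewrite -ee'.
have h2 : e' <= q by rewrite -e'q.
have h3 (c : 'I_n.+1) : c \in [set p; q] -> c < q -> c <= e.
  by rewrite !inE => /orP[]/eqP-> //; rewrite ltnn.
have := dg e e' eD e'D h1 h2 h3; rewrite !edge_rel_spine /spine_edge ae ae' -e'q.
by rewrite -ee' !(ltnSn, ltnn, leqnSn).
Qed.

(* The two final edges, together with a long edge [1], form the triangle [u],
   which keeps the block from being a degeneracy of [1]. *)
Definition block_spine (k : nat) := nseq k true ++ [:: false; false].

(** The block spines are laid end to end and [D] consists of [p] and their end points; each block
    contributes one tensor product whose arity is its number of 1s. *)
Lemma tensor_blocks ks p q :
  q = p + size (flatten (map block_spine ks)) :> nat ->
  (forall i, i < size (flatten (map block_spine ks)) ->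
     a (p + i) = nth false (flatten (map block_spine ks)) i) ->
  exists2 D, between p q D &
    ops_of X p D (interval p q) = [seq (false, k) | k <- ks].
Proof.
elim: ks p => [|k ks IH] p /= hq ha.
  have -> : q = p by apply: val_inj; rewrite /= hq addn0.
  exists [set p]; first exact: between_point.
  by rewrite interval_point /ops_of act_seq_point.
have sk : size (block_spine k) = k.+2 by rewrite size_cat size_nseq /= addn2.
rewrite size_cat sk in hq ha.
have hr i : i <= k.+2 -> p + i < n.+1.
  by move=> hi; apply: leq_ltn_trans (ltn_ord q); rewrite hq leq_add2l
    (leq_trans hi) // leq_addr.
(* [r] is the end of the first block, which has [k] edges labelled 1 and two labelled 0. *)
pose r := Ordinal (hr _ (leqnn _)).
have pr : p <= r by rewrite /= leq_addr.
have rq : r <= q by rewrite /= hq addnA leq_addr.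
have [||D bD hD] := IH r; first by rewrite hq addnA.
  move=> i hi; rewrite /= -addnA ha ?nth_cat ?sk ?ltn_add2l //.
  by rewrite ltnNge leq_addr addKn.
have Xpr : X p r.
  by rewrite edge_rel_spine /spine_edge /= !addnS !ltnS leq_addr leqW ?leq_addr.
have bpr := between_pair pr.
exists ([set p; r] :|: D); first exact: between_union bpr bD.
rewrite (interval_union pr rq) (ops_of_union (@edge_rel_le _ x) bpr bD
  (between_interval pr) (between_interval rq) (between_sub bpr)
  (between_sub bD)) hD.
have aE i : i < k.+2 -> a (p + i) = nth false (block_spine k) i.
  by move=> hi; rewrite ha ?nth_cat ?sk ?hi // ltn_addr.
rewrite ops_of_pair ?between_interval //; congr cons; congr pair.
  have ak : a (p + k) = false.
    by rewrite aE ?leqnSn // nth_cat size_nseq ltnn subnn.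
  have ak1 : a (p + k.+1) = false.
    by rewrite aE // nth_cat size_nseq ltnNge leqnSn /= subSn // subnn.
  have hk : k <= k.+2 by rewrite leqW.
  apply: (@nondegenerate_pair _ _ _ (Ordinal (hr k hk))
    (Ordinal (hr k.+1 (leqnSn _)))); rewrite ?inE /= ?addnS ?leq_addr //.
  - by rewrite !leqW ?leq_addr.
  - by rewrite leqnSn leqW ?leq_addr.
  - by rewrite -addnS.
rewrite size_act_seq_interval // /= addKn.
have -> : iota p k.+2 = [seq p + i | i <- iota 0 k.+2].
  by rewrite -iotaDl addn0.
rewrite count_map.
have -> : count (preim (addn p) a) (iota 0 k.+2) = count id (block_spine k).
  rewrite -[block_spine k in RHS](mkseq_nth false) sk count_map.
  apply: eq_in_count => i; rewrite mem_iota add0n => /aE; exact.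
by rewrite count_cat count_nseq /= !addn0 mul1n.
Qed.
End Spine.

(** * Realization of gamma and [iota] in values of the simplicial map *)

(** The largest set comes first, because arrows point from the larger subset to the smaller. *)
Definition chain3 n (p q : 'I_n.+1) (C D E : {set 'I_n.+1})
  (bC : between p q C) (bD : between p q D) (bE : between p q E)
  (CD : C \subset D) (DE : D \subset E) : chain p q 2.
Proof.
apply: (@Chain n p q 2 (fun i => nth C [:: E; D; C] i)).
- by case=> [] [|[|[|?]]].
- have CE := subset_trans CD DE.
  by case=> [] [|[|[|?]]] ? // [] [|[|[|?]]] ? //= _; rewrite subxx.
Defined.

Definition I3_0 : 'I_3 := @Ordinal 3 0 isT.
Definition I3_1 : 'I_3 := @Ordinal 3 1 isT.
Definition I3_2 : 'I_3 := @Ordinal 3 2 isT.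

(* [o01], [o12] and [o02] are the operations along the edges of a 2-simplex
   occurring in the values of the simplicial maps [alpha]. *)
Definition realized (o01 o12 o02 : ops) :=
  exists n (x : catalan_simp n) (p q : 'I_n.+1) (c : chain p q 2),
    let P := simp_pattern x c in
    [/\ pop P I3_0 I3_1 = o01, pop P I3_1 I3_2 = o12 & pop P I3_0 I3_2 = o02].

(** Blocks for [ks] make the inner operations tensor products. Two further edges labelled 0 do the
    same for the two operations onto the pair of end points, even in arity one. *)
Lemma realized_gamma ks :
  realized [seq (false, k) | k <- ks] [:: (false, size ks)] [:: (false, sumn ks)].
Proof.
pose s := flatten (map block_spine ks); pose a := nth false s.
have hr i : i <= 2 -> size s + i < (size s + 2).+1 by rewrite ltnS leq_add2l.
pose p : 'I_(size s + 2).+1 := ord0; pose q : 'I_(size s + 2).+1 := ord_max.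
pose r := Ordinal (hr 0 isT); pose r' := Ordinal (hr 1 isT).
have pr : p <= r by []. have rq : r <= q by rewrite /= leq_add2l.
have [|i _|D bD hD] := @tensor_blocks _ a ks p r.
- by rewrite /= addn0.
- by rewrite add0n.
(* The default value of [nth] labels the two added edges 0. *)
have a0 i : size s <= i -> a i = false by move=> h; rewrite /a nth_default.
set X := edge_rel (spine_simp (size s + 2) a) in hD.
have Xlt := @edge_rel_lt _ (spine_simp (size s + 2) a).
have Xle := @edge_rel_le _ (spine_simp (size s + 2) a).
have brq := between_interval rq; have bpr := between_interval pr.
have pq : p <= q by [].
have bpq := between_interval pq.
(* The middle set contains the whole tail, so the triangle [u] on [r], [r'], [q] is visible in it,
   at no cost in active elements. *)
pose D1 := D :|: interval r q.
have bD1 : between p q D1 := between_union bD brq.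
have Xpq : X p q by rewrite /X edge_rel_spine /spine_edge /= addn2.
have hD1 : ops_of X p D1 (interval p q) = [seq (false, k) | k <- ks].
  rewrite (interval_union pr rq) (ops_of_union Xle bD brq bpr brq
    (between_sub bD) (subxx _)) hD ops_of_interval_nil ?cats0 //=.
  by rewrite addn0 addKn /= !a0 ?leqnSn.
have szD1 : size (act_seq X p D1) = size ks.
  by rewrite -(size_ops_of X p D1 (interval p q)) hD1 size_map.
have szE : size (act_seq X p (interval p q)) = sumn ks.
  rewrite -(sumn_ops_of Xlt Xle bD1 bpq (between_sub bD1)) hD1 /unzip2 -map_comp.
  by rewrite map_id.
have nondeg (E : {set 'I_(size s + 2).+1}) :
    D1 \subset E -> degenerate X [set p; q] E q = false.
  move/subsetP=> sub; apply: (@nondegenerate_pair _ _ _ _ _ r r') => //=.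
  - by apply: sub; rewrite !inE leqnn /= leq_add2l orbT.
  - by apply: sub; rewrite !inE /= !leq_add2l orbT.
  - by rewrite addn0 addn1.
  - by rewrite addn1 addn2.
  - by rewrite a0 ?addn0.
  - by rewrite a0 ?leq_addr.
exists _, (spine_simp (size s + 2) a), p, q.
exists (chain3 (between_pair pq) bD1 bpq (pair_sub bD1) (between_sub bD1)).
split; rewrite /= ?ops_of_pair //.
- by rewrite nondeg // szD1.
- by rewrite nondeg ?between_sub // szE.
Qed.

(** Two degenerate inclusions can compose to a nondegenerate one: the triangles 0, 1, 3 and 1, 2, 3
    are degeneracies of 1, whereas the whole 3-simplex is not. *)
Lemma realized_iota : realized [:: (true, 1)] [:: (true, 1)] [:: (false, 1)].
Proof.
(* The spine has labels 0, 0, 1, and the middle set [D] omits the vertex 2. *)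
pose a i := i == 2.
pose v0 : 'I_4 := @Ordinal 4 0 isT; pose v1 : 'I_4 := @Ordinal 4 1 isT.
pose v2 : 'I_4 := @Ordinal 4 2 isT; pose v3 : 'I_4 := @Ordinal 4 3 isT.
pose x := spine_simp 3 a; pose X := edge_rel x.
have Xlt := @edge_rel_lt _ x; have Xle := @edge_rel_le _ x.
have b01 : between v0 v1 [set v0; v1] by exact: between_pair.
have b13 : between v1 v3 [set v1; v3] by exact: between_pair.
pose D := [set v0; v1] :|: [set v1; v3].
have bD : between v0 v3 D := between_union b01 b13.
have b03 : between v0 v3 (interval v0 v3) by exact: between_interval.
have i01 : interval v0 v1 = [set v0; v1].
  by apply/setP=> -[] [|[|[|[|?]]]] //= ?; rewrite !inE.
have i13 : interval v0 v3 = [set v0; v1] :|: interval v1 v3.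
  by rewrite -i01; exact: interval_union.
have bi13 : between v1 v3 (interval v1 v3) by exact: between_interval.
have DE : D \subset interval v0 v3 by exact: between_sub bD.
have XE i j : X i j = spine_edge a i j by exact: edge_rel_spine.
have hDE : ops_of X v0 D (interval v0 v3) = [:: (true, 1)].
  rewrite i13 (ops_of_union Xle b01 b13 b01 bi13 (subxx _) (between_sub b13)).
  rewrite -i01 ops_of_interval_nil // ops_of_pair ?XE //.
  rewrite size_act_seq_interval //= ; congr [:: (_, _)].
  apply/degenerateP=> e e'; rewrite !inE !edge_rel_spine => he he' _ _ _.
  by case: e e' he he' => [] [|[|[|[|?]]]] // ? [] [|[|[|[|?]]]].
have szD : size (act_seq X v0 D) = 1.
  by rewrite -(size_ops_of X v0 D (interval v0 v3)) hDE.
have hCD : ops_of X v0 [set v0; v3] D = [:: (true, 1)].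
  rewrite ops_of_pair ?XE // szD; congr [:: (_, _)].
  apply/degenerateP=> e e'; rewrite !inE !edge_rel_spine => he he' _ _ _.
  by case: e e' he he' => [] [|[|[|[|?]]]] // ? [] [|[|[|[|?]]]].
have hCE : ops_of X v0 [set v0; v3] (interval v0 v3) = [:: (false, 1)].
  rewrite ops_of_pair ?XE // size_act_seq_interval //=; congr [:: (_, _)].
  have h (c : 'I_4) : c \in [set v0; v3] -> c < v3 -> c <= v0.
    by rewrite !inE => /orP[]/eqP->.
  (* All edges among 0, 2, 3 have label 1, which degeneracy forbids. *)
  apply/negP=> /degenerateP/(_ v0 v2); rewrite !inE => /(_ isT isT isT isT h).
  by rewrite !edge_rel_spine.
exists 3, x, v0, v3.
exists (chain3 (@between_pair 3 v0 v3 isT) bD b03 (pair_sub bD) DE).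
by split; rewrite /= ?hDE ?hCD ?hCE.
Qed.

Lemma ap_ob_tens (M : lax_monoidal_category) xs :
  ap_ob [:: (false, size xs)] xs = [:: tens_ob (tens M) xs].
Proof. by rewrite /ap_ob /dec /= take_size. Qed.

Lemma ap_mor_tens (M : lax_monoidal_category) fs :
  ap_mor [:: (false, size fs)] fs = [:: tens_mor (tens M) fs].
Proof. by rewrite /ap_mor /dec /= take_size. Qed.

(** With all flags [false], every comparison is an identity and gamma alone remains. *)
Lemma ap_two_gamma (M : lax_monoidal_category) xss :
  ap_two [:: (false, sumn (map size xss))] [:: (false, size (map size xss))]
    [seq (false, k) | k <- map size xss] (flatten xss) = [:: @lm_gamma M xss].
Proof.
have decE : dec [seq (false, k) | k <- map size xss] (flatten xss) =
    [seq (false, xs) | xs <- xss].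
  rewrite -/(shape xss) /dec.
  have -> : unzip2 [seq (false, k) | k <- shape xss] = shape xss.
    by rewrite /unzip2 -map_comp map_id.
  by rewrite flattenK; elim: xss => //= xs xss ->.
rewrite /ap_two /blocks decE /dec /= take_oversize ?size_map //.
rewrite /two_cell /comparison.
have -> : op_tenss [seq (false, xs) | xs <- xss] =
    map idm (map (tens_ob (tens M)) xss).
  by rewrite /op_tenss -!map_comp.
have -> : op_obs [seq (false, xs) | xs <- xss] = map (tens_ob (tens M)) xss.
  by rewrite /op_obs -!map_comp.
have -> : unzip2 [seq (false, xs) | xs <- xss] = xss.
  by rewrite /unzip2 -map_comp map_id.
rewrite tens_mor_idm tcomp_idl ?cod_idm //=.
by rewrite tcomp_idr // dom_gamma.
Qed.

(** The comparison of two composed identity functors with the unary tensor product involves [iota]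
    twice; the right unit law cancels one of them against gamma. *)
Lemma ap_two_iota (M : lax_monoidal_category) x :
  ap_two [:: (false, 1)] [:: (true, 1)] [:: (true, 1)] [:: x] =
  [:: @lm_iota M x].
Proof.
rewrite /ap_two /blocks /dec /=.
have := @op_tens_two_cell M true true [:: (true, [:: x])] isT.
by rewrite /= tcomp_idr ?dom_iota // => <-.
Qed.

(** * Recovery of the data from the simplicial map *)

Lemma nsimp_congr n (X Y : nsimp n) : X = Y ->
  [/\ forall i, nob X i = nob Y i,
      forall (i j : 'I_n.+1) (ij : i <= j) x y, hlist x = hlist y ->
        hlist (Fo (nfun X ij) x : hprod Ob _) =
        hlist (Fo (nfun Y ij) y : hprod Ob _),
      forall (i j : 'I_n.+1) (ij : i <= j) f g, hlist f = hlist g ->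
        hlist (Fm (nfun X ij) f : hprod Mor _) =
        hlist (Fm (nfun Y ij) g : hprod Mor _) &
      forall (i j k : 'I_n.+1) (ij : i <= j) (jk : j <= k) (ik : i <= k) x y,
        hlist x = hlist y ->
        hlist (nnat X ij jk ik x : hprod Mor _) =
        hlist (nnat Y ij jk ik y : hprod Mor _)].
Proof. by move=> <-; split=> // > /hlist_inj ->. Qed.

Section Recover.
Variables M N : lax_monoidal_category.
Hypothesis alphaMN : alpha M = alpha N.

Lemma diagram_recover n (x : catalan_simp n) p q k (c : chain p q k) :
  diagram M (simp_pattern x c) = diagram N (simp_pattern x c).
Proof.
exact: (congr1 (fun F : smap Catalan (hc_nerve N2Cat) =>
                  fhom (F n x) p q k c : nsimp k) alphaMN).
Qed.

(** In the simplex realizing [iota] the exponent at the middle vertex is 1, so the word there has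
    the underlying category as its only letter. *)
Lemma lm_cat_recover : lm_cat M = lm_cat N.
Proof.
have [n [x [p [q [c [h01 h12 h02]]]]]] := realized_iota.
have [/(_ I3_1) + _ _ _] := nsimp_congr (diagram_recover x c).
rewrite [nob _ _]/(nseq (par _ _) _) [X in _ = X]/(nseq (par _ _) _).
by rewrite -(size_pop (simp_pattern x c) (isT : I3_0 <= I3_1)) h01 => -[].
Qed.

Variables o01 o12 o02 : ops.
Hypothesis real : realized o01 o12 o02.

(** Entries are paired with their category, since the categories of [M] and [N] need not be
    convertible here. *)
Lemma ap_recover (xs : seq (Ob (lm_cat M))) (ys : seq (Ob (lm_cat N))) :
  size xs = sumn (unzip2 o01) ->
  map (existT Ob _) xs = map (existT Ob _) ys ->
  map (existT Ob _) (ap_ob o01 xs) = map (existT Ob _) (ap_ob o01 ys) /\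
  map (existT Mor _) (ap_two o02 o12 o01 xs) =
  map (existT Mor _) (ap_two o02 o12 o01 ys).
Proof.
move: real => [n [x [p [q [c [<- <- <-]]]]]].
have h01 : I3_0 <= I3_1 by []. have h12 : I3_1 <= I3_2 by [].
have h02 : I3_0 <= I3_2 by [].
rewrite (sumn_pop (simp_pattern x c) h01) => e exy.
have e' : size ys = par (simp_pattern x c) I3_0.
  by move/(congr1 size): exy; rewrite !size_map e.
have [_ hO _ hN] := nsimp_congr (diagram_recover x c).
have h : hlist (seqh e) = hlist (seqh e') by rewrite !hlist_hseq !seqhK.
have := hO _ _ h01 _ _ h; have := hN _ _ _ h01 h12 h02 _ _ h.
by rewrite !hlist_nnat !hlist_nfun_ob !seqhK.
Qed.

Lemma ap_mor_recover (fs : seq (Mor (lm_cat M))) (gs : seq (Mor (lm_cat N))) :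
  size fs = sumn (unzip2 o01) ->
  map (existT Mor _) fs = map (existT Mor _) gs ->
  map (existT Mor _) (ap_mor o01 fs) = map (existT Mor _) (ap_mor o01 gs).
Proof.
move: real => [n [x [p [q [c [<- _ _]]]]]].
have h01 : I3_0 <= I3_1 by [].
rewrite (sumn_pop (simp_pattern x c) h01) => e exy.
have e' : size gs = par (simp_pattern x c) I3_0.
  by move/(congr1 size): exy; rewrite !size_map e.
have [_ _ hM _] := nsimp_congr (diagram_recover x c).
have h : hlist (seqh e) = hlist (seqh e') by rewrite !hlist_hseq !seqhK.
by have := hM _ _ h01 _ _ h; rewrite !hlist_nfun_mor !seqhK.
Qed.
End Recover.

Lemma alpha_inj : injective alpha.
Proof.
move=> M N h; have eA := lm_cat_recover h.
case: M N eA h => A T g i a1 a2 a3 a4 a5 a6 a7 a8 a9.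
case=> A' T' g' i' b1 b2 b3 b4 b5 b6 b7 b8 b9.
(* The underlying categories are identified before the structures are compared, so that both live
   over [A]. *)
move=> /= eA; case: _ / eA T' g' i' b1 b2 b3 b4 b5 b6 b7 b8 b9.
move=> T' g' i' b1 b2 b3 b4 b5 b6 b7 b8 b9.
set M := LaxMonoidal _ _ _ _ _ _ _ _ _; set N := LaxMonoidal _ _ _ _ _ _ _ _ _ => h.
(* Each single tensor product is the first edge of the simplex realizing gamma for a one-element
   list of arities. *)
have eob xs : tens_ob T xs = tens_ob T' xs.
  have [||/map_existT_inj e _] :=
    @ap_recover M N h _ _ _ (realized_gamma [:: size xs]) xs xs => //.
    by rewrite /= addn0.
  suff [->] : [:: tens_ob T xs] = [:: tens_ob T' xs] by [].
  by rewrite -(@ap_ob_tens M) -(@ap_ob_tens N); exact: e.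
have emor fs : tens_mor T fs = tens_mor T' fs.
  have sz : size fs = sumn (unzip2 [seq (false, k) | k <- [:: size fs]]).
    by rewrite /= addn0.
  have /map_existT_inj e :=
    @ap_mor_recover M N h _ _ _ (realized_gamma [:: size fs]) fs fs sz erefl.
  suff [->] : [:: tens_mor T fs] = [:: tens_mor T' fs] by [].
  by rewrite -(@ap_mor_tens M) -(@ap_mor_tens N); exact: e.
(* Every tuple comes from a list, so the actions on lists determine the functors. *)
have eT : T = T'.
  apply: functional_extensionality_dep => n; apply: functor_eq => x.
    by rewrite -(hseqK (size_hseq x)) !Fo_seqh.
  by rewrite -(hseqK (size_hseq x)) !Fm_seqh.
have eg : g = g'.
  apply: functional_extensionality => xss.
  have := ap_recover h (realized_gamma (map size xss)).
  move=> /(_ (flatten xss) (flatten xss)) [] //.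
    by rewrite /unzip2 -map_comp map_id size_flatten.
  move=> _ /map_existT_inj; rewrite (@ap_two_gamma M) (@ap_two_gamma N).
  by case.
have ei : i = i'.
  apply: functional_extensionality => x.
  have [] // := ap_recover h realized_iota (xs := [:: x]) (ys := [:: x]).
  by move=> _ /map_existT_inj; rewrite (@ap_two_iota M) (@ap_two_iota N) => -[].
rewrite /M /N; clear h eob emor M N; subst T' g' i'.
by congr LaxMonoidal; exact: proof_irrelevance.
Qed.

Theorem proposition2p7 :
  exists alpha : lax_monoidal_category -> smap Catalan (hc_nerve N2Cat),
    injective alpha.
Proof. by exists alpha; exact: alpha_inj. Qed.
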